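(* Consider the impulsive system $\dot x(t)=f(t,x(t),u(t))$ for $t\notin\gamma$, $x(t)=x(t^-)+g(t,x(t^-),u(t))$ for $t\in\gamma$ (see context), and let $h^o,h:\mathbb{R}_{\ge 0}\times\mathbb{R}^n\to\mathbb{R}_{\ge 0}$. Let $V$ be an $(h^o,h)$-ISS Lyapunov function candidate for this system, with associated functions $\chi,\pi,p,\varphi,\psi$, such that $\psi,\varphi\in\mathcal{P}$. Suppose that there exists $\theta>0$ such that $$M:=\sup_{a>0}\int_a^{\psi(a)}\frac{ds}{\varphi(s)}\;<\;\inf_{t\ge 0}\int_t^{t+\theta}p(s)\,ds=:N .$$ Then the following hold. (a) If $M>0$, then the system is strongly $(h^o,h)$-ISS over any $\mathcal{S}\subset\Gamma$ that is a uniform subset of $\bar{\mathcal{S}}\left(\frac1\theta\right)$. (b) If $M=0$, then the system is weakly $(h^o,h)$-ISS over $\mathcal{S}=\Gamma$ and strongly $(h^o,h)$-ISS over any UIB family $\mathcal{S}\subset\Gamma$. (c) If $M<0<N$, then the system is strongly $(h^o,h)$-ISS over $\mathcal{S}=\Gamma$.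
   Context: Function classes. $\mathcal{C}_*$: continuous $\varphi:\mathbb{R}_{\ge0}\to\mathbb{R}_{\ge0}$ with $\varphi(0)=0$. $\mathcal{P}$: those $\varphi\in\mathcal{C}_*$ with $\varphi(s)>0$ for $s>0$. $\mathcal{K}$: strictly increasing elements of $\mathcal{C}_*$. $\mathcal{K}_\infty$: unbounded elements of $\mathcal{K}$. $\mathcal{KL}$: continuous $\beta:\mathbb{R}_{\ge0}\times\mathbb{R}_{\ge0}\to\mathbb{R}_{\ge0}$ with $\beta(\cdot,t)\in\mathcal{K}$ for all $t\ge0$, $\beta(r,\cdot)$ strictly decreasing whenever positive, and $\lim_{t\to\infty}\beta(r,t)=0$ for all $r\ge 0$. Impulse-time sequences. $\Gamma$ is the set of all strictly increasing sequences $\gamma=\{\tau_k\}_{k=1}^{N_\gamma}\subset(0,\infty)$, with $N_\gamma$ finite or $N_\gamma=\infty$, having no finite limit points ($\tau_k\to\infty$ if infinite). Put $\tau_0=0$ (never an impulse time) and $\tau_{N_\gamma+1}=\infty$ if $N_\gamma$ is finite. Sequences are identified with their sets of values. $n^\gamma_{(s,t]}:=\#(\gamma\cap(s,t])$. System. $f,g:\mathbb{R}_{\ge0}\times\mathbb{R}^n\times\mathbb{R}^m\to\mathbb{R}^n$. $\mathcal{U}$ is the set of inputs, i.e. Lebesgue measurable, locally essentially bounded $u:[0,\infty)\to\mathbb{R}^m$. Standing assumption: for each $u\in\mathcal{U}$, $(t,\xi)\mapsto f(t,\xi,u(t))$ is a Carathéodory function (so that local existence of solutions of $\dot x=f(t,x,u(t))$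 holds; uniqueness is not assumed). A solution for initial time $t_0\ge0$, initial state $x_0\in\mathbb{R}^n$, input $u$ and $\gamma\in\Gamma$ is a function $x:[t_0,T_x)\to\mathbb{R}^n$ with: $x(t_0)=x_0$; on each nonempty $J_k=[\tau_k,\tau_{k+1})\cap[t_0,T_x)$, $x$ is locally absolutely continuous and $\dot x(t)=f(t,x(t),u(t))$ for a.a. $t\in J_k$; for every $\tau_k\in(t_0,T_x)$ the left limit $x(\tau_k^-)$ exists, is finite, and $x(\tau_k)=x(\tau_k^-)+g(\tau_k,x(\tau_k^-),u(\tau_k))$. It is maximally defined if no solution $y:[t_0,T_y)\to\mathbb{R}^n$ with $T_y>T_x$ coincides with $x$ on $[t_0,T_x)$. $\mathcal{T}(t_0,x_0,u,\gamma)$ is the set of maximally defined solutions. Input bound: for an interval $I\subset\mathbb{R}_{\ge0}$, $\|u_I\|_\gamma:=\max\{\operatorname{ess\,sup}_{t\in I}|u(t)|,\ \sup_{t\in\gamma\cap I}|u(t)|\}$ (suprema over empty sets being $0$). Stability. For $\mathcal{S}\subset\Gamma$, the system is weakly $(h^o,h)$-ISS over $\mathcal{S}$ if there exist $\beta\in\mathcal{KL}$, $\rho\in\mathcal{K}_\infty$ such that for all $t_0\ge0$, $x_0\in\mathbb{R}^n$, $u\in\mathcal{U}$, $\gamma\in\mathcal{S}$, $x\in\mathcal{T}(t_0,x_0,u,\gamma)$ and $t\in[t_0,T_x)$: $h(t,x(t))\le\beta(h^o(t_0,x_0),t-t_0)+\rho(\|u_{(t_0,t]}\|_\gamma)$.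 It is strongly $(h^o,h)$-ISS over $\mathcal{S}$ if the same holds with $\beta(h^o(t_0,x_0),\,t-t_0+n^\gamma_{(t_0,t]})$ in place of $\beta(h^o(t_0,x_0),t-t_0)$. Lyapunov function candidate. A locally Lipschitz $V:\mathbb{R}_{\ge0}\times\mathbb{R}^n\to\mathbb{R}$ is an $(h^o,h)$-ISS Lyapunov function candidate if: (a) there are $\phi_1,\phi_2\in\mathcal{K}_\infty$ with $\phi_1(h(t,\xi))\le V(t,\xi)\le\phi_2(h^o(t,\xi))$ for all $t\ge0$, $\xi\in\mathbb{R}^n$; (b) there are $\chi,\pi\in\mathcal{K}_\infty$, a locally integrable $p:\mathbb{R}_{\ge0}\to\mathbb{R}_{\ge0}$, a continuous $\varphi:\mathbb{R}_{\ge0}\to\mathbb{R}$ and $\psi\in\mathcal{P}$ such that for all $t\ge0$, $\xi\in\mathbb{R}^n$, $\mu\in\mathbb{R}^m$: (i) $D_f^+V(t,\xi,\mu)\le-p(t)\varphi(V(t,\xi))$ if $V(t,\xi)\ge\chi(|\mu|)$; (ii) $V(t,\xi+g(t,\xi,\mu))\le\psi(V(t,\xi))$ if $V(t,\xi)\ge\chi(|\mu|)$; (iii) $V(t,\xi+g(t,\xi,\mu))\le\pi(|\mu|)$ if $V(t,\xi)\le\chi(|\mu|)$. Here $D_f^+V(t,\xi,\mu):=\limsup_{\epsilon\to0^+}\frac{V(t+\epsilon,\xi+\epsilon f(t,\xi,\mu))-V(t,\xi)}{\epsilon}$. Classes of sequences. $\mathcal{S}\subset\Gamma$ is UIB (uniformly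 incrementally bounded) if there is a continuous nondecreasing $\phi:\mathbb{R}_{>0}\to\mathbb{R}_{\ge0}$ with $n^\gamma_{(s,t]}\le\phi(t-s)$ for all $t>s\ge0$, $\gamma\in\mathcal{S}$. For $\rho\ge0$, $\bar{\mathcal{S}}(\rho)$ is the set of $\gamma\in\Gamma$ such that for every $\varepsilon>0$ there is $T=T(\gamma,\varepsilon)>0$ with $n^\gamma_{(s,s+t]}/t\le\rho+\varepsilon$ for all $t\ge T$, $s\ge0$. $\mathcal{S}$ is a uniform subset of $\bar{\mathcal{S}}(\rho)$ if $\mathcal{S}\subset\bar{\mathcal{S}}(\rho)$ and $T$ can be chosen independently of $\gamma\in\mathcal{S}$. *)

(* Defs.v *)
From HB Require Import structures.
From mathcomp Require Import all_boot all_order all_algebra.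
From mathcomp Require Import finmap.
From mathcomp Require Import all_classical all_reals all_analysis.
From mathcomp Require Import ess_sup_inf.

Set Implicit Arguments.
Unset Strict Implicit.
Unset Printing Implicit Defensive.

Import Order.TTheory GRing.Theory Num.Theory.
Import numFieldNormedType.Exports.

Local Open Scope classical_set_scope.
Local Open Scope ring_scope.

(* Conventions.  A function on [0, +oo[ is represented by a total function on R
   of which only the values at nonnegative arguments are constrained or used.
   The norm |.| applied to input values is the Euclidean norm [enorm].
   Lebesgue measurability and integrability refer to the completed
   sigma-algebra and measure; almost-everywhere statements use
   [lebesgue_measure], whose negligible sets are the same. *)

Section comparison_functions.
Variable R : realType.
Implicit Types (phi : R -> R) (beta : R -> R -> R).

Definition classC0 phi :=
  [/\ {within `[0, +oo[, continuous phi},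
      forall s : R, 0 <= s -> 0 <= phi s
    & phi 0 = 0].

Definition classP phi := classC0 phi /\ forall s : R, 0 < s -> 0 < phi s.

Definition classK phi :=
  classC0 phi /\ forall s t : R, 0 <= s -> s < t -> phi s < phi t.

Definition classKoo phi :=
  classK phi /\ forall A : R, exists2 s : R, 0 <= s & A < phi s.

Definition classKL beta :=
  [/\ {within [set z : R * R | 0 <= z.1 /\ 0 <= z.2],
         continuous (fun z => beta z.1 z.2)},
      forall t : R, 0 <= t -> classK (beta ^~ t),
      forall r s t : R, 0 <= r -> 0 <= s -> s < t ->
        0 < beta r s -> beta r t < beta r s
    & forall r, 0 <= r -> beta r t @[t --> +oo] --> (0 : R)].

End comparison_functions.

Section impulse_times.
Variable R : realType.
Implicit Types (gam : set R) (S : set (set R)) (rho : R).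

(* The set Gamma: sets of values of the strictly increasing finite
   ([path <%R 0 s] says 0 < s_1 < s_2 < ...) or infinite sequences. *)
Definition Gamma : set (set R) := [set gam |
  (exists2 s : seq R, path <%R 0 s & gam = [set` s]) \/
  (exists tau : nat -> R,
     [/\ 0 < tau 0%N, {homo tau : i j / (i < j)%N >-> i < j},
         tau @ \oo --> +oo & gam = range tau])].

Definition n_imp gam (s t : R) : nat := #|` fset_set (gam `&` `]s, t]) |.

Definition UIB S := exists phi : R -> R,
  [/\ {within `]0, +oo[, continuous phi},
      forall s : R, 0 < s -> 0 <= phi s,
      forall s t : R, 0 < s -> s <= t -> phi s <= phi t
    & forall gam (s t : R), S gam -> 0 <= s -> s < t ->
        (n_imp gam s t)%:R <= phi (t - s)].

Definition rate_bound gam rho (eps T : R) := forall s t : R, 0 <= s -> T <= t ->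
  (n_imp gam s (s + t))%:R / t <= rho + eps.

Definition Sbar rho : set (set R) := [set gam | Gamma gam /\
  forall eps : R, 0 < eps -> exists2 T : R, 0 < T & rate_bound gam rho eps T].

Definition uniform_subset_Sbar S rho := S `<=` Sbar rho /\
  forall eps : R, 0 < eps -> exists2 T : R, 0 < T &
    forall gam, S gam -> rate_bound gam rho eps T.

(* For tau = tau_k in gam or tau = tau_0 = 0, this is
   [tau_k, tau_{k+1}[ intersected with [t0, T[. *)
Definition flow_interval gam (t0 : R) (T : \bar R) (tau : R) : set R :=
  [set t | [/\ tau <= t, t0 <= t, (t%:E < T)%E
             & forall s : R, gam s -> tau < s -> t < s]].

End impulse_times.

Section systems.
Variables (R : realType) (n m : nat).
Implicit Types (f g : R -> 'rV[R]_n -> 'rV[R]_m -> 'rV[R]_n).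
Implicit Types (u : R -> 'rV[R]_m) (x : R -> 'rV[R]_n) (gam : set R).

Definition enorm (k : nat) (v : 'rV[R]_k) : R :=
  Num.sqrt (\sum_i v ord0 i ^+ 2).

(* [completed_lebesgue_measure] is defined on this Caratheodory sigma-algebra,
   that of the Lebesgue measurable sets. *)
Definition leb_measurable_fun (D : set R) (k : nat) (F : R -> 'rV[R]_k) :=
  forall i, measurable_fun
    (D : set (caratheodory_type ((@wlength R idfun)^*)%mu))
    (fun t => F t ord0 i).

Definition loc_integrable (q : R -> R) := forall T : R, 0 <= T ->
  (@completed_lebesgue_measure R).-integrable `[0, T] (EFin \o q).

Definition is_input u := leb_measurable_fun `[0, +oo[ u /\
  forall T : R, 0 <= T -> exists C : R,
    {ae @lebesgue_measure R, forall t, 0 <= t <= T -> enorm (u t) <= C}.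

Definition caratheodory (F : R -> 'rV[R]_n -> 'rV[R]_n) :=
  [/\ forall xi, leb_measurable_fun `[0, +oo[ (F ^~ xi),
      {ae @lebesgue_measure R, forall t, 0 <= t -> continuous (F t)}
    & forall K : set (R * 'rV[R]_n), compact K ->
        K `<=` [set z | 0 <= z.1] ->
        exists2 q : R -> R, loc_integrable q &
          {ae @lebesgue_measure R,
             forall t : R, forall xi, K (t, xi) -> enorm (F t xi) <= q t}].

Definition abs_continuous (a b : R) x := forall eps : R, 0 < eps ->
  exists2 del : R, 0 < del & forall (N : nat) (c d : nat -> R),
    (forall k, (k < N)%N -> [/\ a <= c k, c k <= d k & d k <= b]) ->
    trivIset `I_N (fun k => `]c k, d k[%classic) ->
    \sum_(k < N) (d k - c k) < del ->
    \sum_(k < N) `|x (d k) - x (c k)| < eps.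

Definition loc_abs_continuous (J : set R) x := forall a b : R, a <= b ->
  `[a, b] `<=` J -> abs_continuous a b x.

(* x is a solution on [t0, T[; values of x elsewhere are irrelevant. *)
Definition is_solution f g (t0 : R) (x0 : 'rV[R]_n) u gam x (T : \bar R) :=
  [/\ (t0%:E < T)%E, x t0 = x0,
      forall tau, tau = 0 \/ gam tau ->
        let J := flow_interval gam t0 T tau in
        loc_abs_continuous J x /\
        {ae @lebesgue_measure R, forall t, J t ->
           is_derive t 1 x (f t (x t) (u t))}
    & forall tau, gam tau -> t0 < tau -> (tau%:E < T)%E ->
        exists2 l : 'rV[R]_n, x @ tau^'- --> l & x tau = l + g tau l (u tau)].

Definition is_maximal_solution f g (t0 : R) (x0 : 'rV[R]_n) u gam x (T : \bar R) :=
  is_solution f g t0 x0 u gam x T /\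
  forall y (T' : \bar R), is_solution f g t0 x0 u gam y T' -> (T < T')%E ->
    ~ forall t : R, t0 <= t -> (t%:E < T)%E -> y t = x t.

(* || u_I ||_gam as an extended real; extending |u| by 0 outside of I makes
   both suprema over empty sets contribute 0. *)
Definition input_enorm u gam (I : set R) : \bar R :=
  maxe (ess_sup (@lebesgue_measure R) ((fun t => (enorm (u t))%:E) \_ I))
       (ereal_sup [set (enorm (u t))%:E | t in gam `&` I]).

(* Finite, so that [fine] is harmless, for u an input, gam in Gamma and I
   bounded. *)
Definition input_norm u gam (I : set R) : R := fine (input_enorm u gam I).

Definition weakly_ISS f g (ho h : R -> 'rV[R]_n -> R) (S : set (set R)) :=
  exists (beta : R -> R -> R) (rho : R -> R), [/\ classKL beta, classKoo rho &
    forall (t0 : R) (x0 : 'rV[R]_n) u gam x T, 0 <= t0 -> is_input u -> S gam ->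
      is_maximal_solution f g t0 x0 u gam x T ->
      forall t : R, t0 <= t -> (t%:E < T)%E ->
        h t (x t) <= beta (ho t0 x0) (t - t0)
                     + rho (input_norm u gam `]t0, t])].

Definition strongly_ISS f g (ho h : R -> 'rV[R]_n -> R) (S : set (set R)) :=
  exists (beta : R -> R -> R) (rho : R -> R), [/\ classKL beta, classKoo rho &
    forall (t0 : R) (x0 : 'rV[R]_n) u gam x T, 0 <= t0 -> is_input u -> S gam ->
      is_maximal_solution f g t0 x0 u gam x T ->
      forall t : R, t0 <= t -> (t%:E < T)%E ->
        h t (x t) <= beta (ho t0 x0) (t - t0 + (n_imp gam t0 t)%:R)
                     + rho (input_norm u gam `]t0, t])].

Definition loc_lipschitz (V : R -> 'rV[R]_n -> R) :=
  forall (t : R) (xi : 'rV[R]_n), 0 <= t ->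
    exists2 U : set (R * 'rV[R]_n), nbhs (t, xi) U &
      [lipschitz V z.1 z.2 | z in U `&` [set z | 0 <= z.1]].

Definition upper_dini f (V : R -> 'rV[R]_n -> R)
    (t : R) (xi : 'rV[R]_n) (mu : 'rV[R]_m) : \bar R :=
  limf_esup (fun eps : R =>
    ((V (t + eps) (xi + eps *: f t xi mu) - V t xi) / eps)%:E) 0^'+.

Definition ISS_Lyapunov_candidate f g (ho h V : R -> 'rV[R]_n -> R)
    (chi pi p vphi psi : R -> R) :=
  [/\ loc_lipschitz V,
      exists phi1 phi2, [/\ classKoo phi1, classKoo phi2 &
        forall (t : R) xi, 0 <= t ->
          phi1 (h t xi) <= V t xi /\ V t xi <= phi2 (ho t xi)],
      [/\ classKoo chi, classKoo pi & classP psi],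
      [/\ forall t : R, 0 <= t -> 0 <= p t, loc_integrable p
        & {within `[0, +oo[, continuous vphi}]
    & forall (t : R) xi mu, 0 <= t ->
        [/\ chi (enorm mu) <= V t xi ->
              (upper_dini f V t xi mu <= (- (p t * vphi (V t xi)))%:E)%E,
            chi (enorm mu) <= V t xi ->
              V t (xi + g t xi mu) <= psi (V t xi)
          & V t xi <= chi (enorm mu) ->
              V t (xi + g t xi mu) <= pi (enorm mu)]].

End systems.

Section dwell_time_quantities.
Variable R : realType.

(* The oriented integral of F from a to b. *)
Definition oriented_int (F : R -> R) (a b : R) : R :=
  if a <= b then \int[@lebesgue_measure R]_(s in `[a, b]) F s
  else - \int[@lebesgue_measure R]_(s in `[b, a]) F s.

Definition jump_sup (vphi psi : R -> R) : \bar R :=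
  ereal_sup [set (oriented_int (fun s => (vphi s)^-1) a (psi a))%:E
            | a in `]0, +oo[].

Definition flow_inf (p : R -> R) (theta : R) : \bar R :=
  ereal_inf [set (\int[@completed_lebesgue_measure R]_(s in `[t, (t + theta)%R])
                    (p s)%:E)%E | t in `[0, +oo[].

End dwell_time_quantities.

(* Main.v *)
Require Import Defs.
From mathcomp Require Import all_boot all_order all_algebra.
From mathcomp Require Import finmap.
From mathcomp Require Import all_classical all_reals all_analysis.
From mathcomp Require Import measurable_realfun ess_sup_inf.
From mathcomp Require Import ring lra.

Import Order.TTheory GRing.Theory Num.Theory.
Import numFieldNormedType.Exports.

Local Open Scope classical_set_scope.
Local Open Scope ring_scope.

Set Implicit Arguments.
Unset Strict Implicit.
Unset Printing Implicit Defensive.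

(* Let v(t) = V(t, x(t)) and let Phi be a primitive of 1/vphi on ]0, +oo[.  While
   v stays above chi(b), with b a bound of the input, Phi(v) decreases along the
   flow at least as fast as the integral of p grows, because v is locally
   absolutely continuous, and increases by at most M at each impulse.  Hence, with
   n impulses in ]r, t],
     Phi(v(t)) <= Phi(v(r)) + M n - int_r^t p,
   and the dwell-time conditions make the right-hand side tend to -oo uniformly
   as the relevant clock (t - r, or t - r + n) tends to infinity.  Since Phi may
   be bounded above, this estimate is useless as long as M n - int_r^t p > 0;
   then n is bounded by a constant K and v(t) <= kap^K(v(r)) for a K-infinity
   majorant kap of psi and of the identity.  If v does not stay above chi(b), the
   same estimates are restarted from the last time at which v is bounded by a
   gain of b.  Uniform boundedness and uniform attractivity are finally turned
   into a KL estimate. *)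

(** * Real induction and comparison functions *)

(** No classical chain rule gives the estimate on [Phi(v)]: [V] is merely locally Lipschitz and [x]
    is differentiable only almost everywhere between impulses. The flow estimate is therefore a
    monotonicity theorem for functions dominated by time plus the variation of an absolutely
    continuous one, whose Dini inequality may fail on a null set. As [p] is integrable for the
    completed measure only, its primitive is replaced by that of a bounded Borel minorant, at an
    arbitrarily small loss of integral.

    An impulse may send [v] to 0, where [Phi] has no value; hence energy inequalities are asserted
    only when the final value is positive.

    The cases of the theorem differ only in the clock and in the bounds on [M n - int p]. Uniformity
    in initial time, input and sequence is built in, because the KL function is constructed from one
    relation that contains the data of every trajectory without a reset. *)

Section real_induction.
Variable R : realType.

(** The supremum of the points up to which [P] holds throughout is again such a point by the
    left-limit step, and the right step would push past it if it were smaller than [b]. *)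
Lemma real_induction (P : R -> Prop) (a b : R) : a <= b -> P a ->
  (forall s, a <= s -> s < b -> P s ->
     exists2 eta, 0 < eta & forall d, s < d -> d < s + eta -> d <= b -> P d) ->
  (forall s, a < s -> s <= b -> (forall r, a <= r -> r < s -> P r) -> P s) ->
  P b.
Proof.
move=> ab Pa stepr stepl.
pose A := [set s | a <= s <= b /\ forall r, a <= r -> r <= s -> P r].
have Aa : A a.
  by split=> [|r ar ra]; [rewrite lexx ab|have -> : r = a by apply/le_anti; rewrite ra ar].
have ubA : ubound A b by move=> s [/andP[]].
have supA : has_sup A by split; [exists a|exists b].
set s := sup A.
have as_ : a <= s by apply: ub_le_sup => //; exists b.
have sb : s <= b by apply: ge_sup => //; exists a.
have Plt r : a <= r -> r < s -> P r.
  move=> ar rs; have := sup_gt (proj1 supA) rs.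
  by move=> [q [_ Aq] rq]; apply: Aq => //; exact: ltW.
have Ps : P s.
  move: as_; rewrite le_eqVlt => /predU1P[<-//|as_]; exact: stepl.
have As : A s.
  split; first by rewrite as_ sb.
  by move=> r ar; rewrite le_eqVlt => /predU1P[->//|]; exact: Plt.
move: sb; rewrite le_eqVlt => /predU1P[<-//|sb].
have [eta eta0 H] := stepr s as_ sb Ps.
pose d := Num.min b (s + eta / 2).
have sd : s < d by rewrite lt_min sb/=; lra.
have : A d.
  split; first by rewrite (le_trans as_ (ltW sd))/= ge_min lexx.
  move=> r ar rd; have [rs|sr] := leP r s; first by apply: (proj2 As).
  apply: H => //.
    apply: le_lt_trans rd _; rewrite gt_min; apply/orP; right; lra.
  by apply: le_trans rd _; rewrite ge_min lexx.
move=> /(ub_le_sup (proj2 supA)); rewrite -/s => ds; lra.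
Qed.

(** Real induction on [rel a]: transitivity appends to what is known up to [s], or up to a point
    slightly before [s], a local pair having [s] as an endpoint. *)
Lemma local_to_global (rel : R -> R -> Prop) (a b : R) : a <= b ->
  (forall c d e, a <= c -> c <= d -> d <= e -> e <= b ->
     rel c d -> rel d e -> rel c e) ->
  (forall s, a <= s -> s <= b -> exists2 eta, 0 < eta &
     forall c d, a <= c -> c <= s -> s <= d -> d <= b -> s - eta < c ->
       d < s + eta -> rel c d) ->
  rel a b.
Proof.
move=> ab tr loc.
apply: (@real_induction (rel a) a b) => //.
- have [eta eta0 H] := loc a (lexx _) ab.
  by apply: H => //; lra.
- move=> s as_ sb Ras; have [eta eta0 H] := loc s as_ (ltW sb).
  exists eta => // d sd ds db.
  apply: (tr _ s) => //; first exact: ltW.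
  by apply: H => //; [exact: ltW|lra].
- move=> s as_ sb Rr; have [eta eta0 H] := loc s (ltW as_) sb.
  pose c := Num.max a (s - eta / 2).
  have cs : c < s by rewrite gt_max as_/=; lra.
  have ac : a <= c by rewrite le_max lexx.
  apply: (tr _ c) => //; first exact: ltW.
    exact: Rr.
  apply: H => //; first exact: ltW.
  - rewrite lt_max; apply/orP; right; lra.
  - lra.
Qed.

End real_induction.

Section comparison.
Variable R : realType.
Implicit Types (f phi : R -> R).

Lemma within_continuousP (A : set R) f : {within A, continuous f} <->
  forall x, A x -> forall e : R, 0 < e -> exists2 d, 0 < d &
    forall y, A y -> `|y - x| < d -> `|f y - f x| < e.
Proof.
split=> [/subspace_continuousP H x Ax e e0|H].
  have /cvgrPdist_lt/(_ e e0) := H x Ax.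
  rewrite /prop_near1/= => /nbhs_ballP[d /= d0 Hd].
  exists d => // y Ay yx; rewrite distrC; apply: Hd => //.
  by rewrite /ball/= distrC.
apply/subspace_continuousP => x Ax; apply/cvgrPdist_lt => e e0.
have [d d0 Hd] := H x Ax e e0.
apply/nbhs_ballP; exists d => //= y; rewrite /ball/= => yx Ay.
by rewrite distrC; apply: Hd => //; rewrite distrC.
Qed.

Lemma itvcyP (x : R) : `[0, +oo[%classic x <-> 0 <= x.
Proof. by rewrite /= in_itv/= andbT. Qed.

Lemma continuous_classC0P phi : {within `[0, +oo[, continuous phi} <->
  forall x, 0 <= x -> forall e : R, 0 < e -> exists2 d, 0 < d &
    forall y, 0 <= y -> `|y - x| < d -> `|phi y - phi x| < e.
Proof.
rewrite within_continuousP; split=> H x /itvcyP x0 e e0.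
  have [d d0 Hd] := H x x0 e e0; exists d => // y /itvcyP; exact: Hd.
have [d d0 Hd] := H x x0 e e0; exists d => // y /itvcyP; exact: Hd.
Qed.

Lemma classK_ge0 phi x : classK phi -> 0 <= x -> 0 <= phi x.
Proof. by move=> [[_ + _] _]; apply. Qed.

Lemma classK0 phi : classK phi -> phi 0 = 0.
Proof. by move=> [[_ _ ->] _]. Qed.

Lemma classK_lt phi x y : classK phi -> 0 <= x -> x < y -> phi x < phi y.
Proof. by move=> [_]; apply. Qed.

Lemma classK_le phi x y : classK phi -> 0 <= x -> x <= y -> phi x <= phi y.
Proof.
move=> Kphi x0; rewrite le_eqVlt => /predU1P[->//|xy].
by apply/ltW/(classK_lt Kphi).
Qed.

Lemma classK_gt0 phi x : classK phi -> 0 < x -> 0 < phi x.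
Proof. by move=> Kphi x0; rewrite -(classK0 Kphi) (classK_lt Kphi). Qed.

Lemma classK_le_inv phi x y : classK phi -> 0 <= y -> phi x <= phi y -> x <= y.
Proof.
move=> Kphi y0; apply: contraTT; rewrite -!ltNge; exact: classK_lt.
Qed.

Lemma classKoo_comp phi1 phi2 : classKoo phi1 -> classKoo phi2 ->
  classKoo (phi1 \o phi2).
Proof.
move=> [K1 U1] [K2 U2]; split; last first.
  move=> A; have [s1 s10 As1] := U1 A; have [s2 s20 As2] := U2 s1.
  exists s2 => //=; apply: lt_le_trans As1 _.
  by apply: (classK_le K1) => //; exact: ltW.
split; last first.
  move=> s t s0 st /=; apply: (classK_lt K1); first exact: (classK_ge0 K2).
  exact: classK_lt.
split; last by rewrite /= (classK0 K2) (classK0 K1).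
- apply/continuous_classC0P => x x0 e e0.
  have [[/continuous_classC0P c1 _ _] _] := K1.
  have [[/continuous_classC0P c2 _ _] _] := K2.
  have [d d0 Hd] := c1 (phi2 x) (classK_ge0 K2 x0) e e0.
  have [d' d'0 Hd'] := c2 x x0 d d0.
  exists d' => // y y0 yx; apply: Hd; first exact: classK_ge0.
  exact: Hd'.
- by move=> s s0 /=; apply: (classK_ge0 K1); exact: (classK_ge0 K2).
Qed.

Lemma classKoo_id : classKoo (@id R).
Proof.
split; last by move=> A; exists (`|A| + 1) => //; have := ler_norm A; lra.
do 2?split=> //; apply: continuous_subspaceT => x; exact: cvg_id.
Qed.

Lemma classKoo_iter phi k : classKoo phi -> classKoo (iter k phi).
Proof.
move=> Kphi; elim: k => [|k IH]; first exact: classKoo_id.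
exact: (classKoo_comp Kphi IH).
Qed.

Lemma classKoo_add phi1 phi2 : classKoo phi1 -> classKoo phi2 ->
  classKoo (fun s => phi1 s + phi2 s).
Proof.
move=> [K1 U1] [K2 U2]; split; last first.
  move=> A; have [s s0 As] := U1 A; exists s => //.
  by have := classK_ge0 K2 s0; lra.
split; last by move=> s t s0 st; apply: ltrD; exact: classK_lt.
split.
- apply/continuous_classC0P => x x0 e e0.
  have [[/continuous_classC0P c1 _ _] _] := K1.
  have [[/continuous_classC0P c2 _ _] _] := K2.
  have e20 : 0 < e / 2 by lra.
  have [d d0 Hd] := c1 x x0 _ e20.
  have [d' d'0 Hd'] := c2 x x0 _ e20.
  exists (Num.min d d'); first by rewrite lt_min d0.
  move=> y y0; rewrite lt_min => /andP[yd yd'].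
  have := Hd y y0 yd; have := Hd' y y0 yd'.
  by rewrite !ltr_norml; lra.
- by move=> s s0; apply: addr_ge0; exact: classK_ge0.
- by rewrite (classK0 K1) (classK0 K2) addr0.
Qed.

Lemma iter_classK_le phi k (x y : R) : classKoo phi -> 0 <= x -> x <= y ->
  iter k phi x <= iter k phi y.
Proof. by move=> /(classKoo_iter k)[K _]; exact: classK_le. Qed.

Lemma iter_ge_le phi (k l : nat) (x : R) : (forall r, 0 <= r -> r <= phi r) ->
  (k <= l)%N -> 0 <= x -> iter k phi x <= iter l phi x.
Proof.
move=> Hphi + x0.
have pos j : 0 <= iter j phi x.
  by elim: j => //= j IH; apply: le_trans IH (Hphi _ IH).
elim: l => [|l IH]; first by rewrite leqn0 => /eqP ->.
rewrite leq_eqVlt => /predU1P[->//|]; rewrite ltnS => /IH kl.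
by apply: le_trans kl (Hphi _ (pos _)).
Qed.

End comparison.

(** * Class K-infinity majorants of relations *)

Section majorants.
Variable R : realType.

Definition tent (x : R) := Num.max 0 (Num.min 1 (2 - x)).

Lemma tent_le1 x : tent x <= 1.
Proof. by rewrite ge_max ler01 ge_min lexx. Qed.
Lemma tent1 x : x <= 1 -> tent x = 1.
Proof.
by move=> x1; rewrite /tent (min_idPl _)// ?(max_idPr _)//; lra.
Qed.
Lemma tent0 x : 2 <= x -> tent x = 0.
Proof. by move=> x2; rewrite /tent (max_idPl _)// ge_min; apply/orP; right; lra. Qed.
Lemma tent_le x y : x <= y -> tent y <= tent x.
Proof.
move=> xy; rewrite /tent; case: (leP 1 (2 - x)); case: (leP 1 (2 - y)) => *;
  rewrite ?(max_idPr ler01)//; try lra.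
- by case: (leP 0 (2 - y)); lra.
- by case: (leP 0 (2 - y)); case: (leP 0 (2 - x)); lra.
Qed.

Lemma tent_lip x y : `|tent x - tent y| <= `|x - y|.
Proof.
wlog xy : x y / x <= y.
  move=> H; have [xy|/ltW xy] := leP x y; first exact: H.
  by rewrite distrC (distrC x); exact: H.
rewrite ger0_norm ?subr_ge0 ?tent_le//; rewrite ler0_norm; last by lra.
rewrite /tent; case: (leP 1 (2 - x)); case: (leP 1 (2 - y)) => ? ?;
  rewrite ?(max_idPr ler01)//; try lra;
  case: (leP 0 (2 - y)); case: (leP 0 (2 - x)); lra.
Qed.

(** The natural candidate, the supremum of the [w] with [a <= r], may jump in [r]. Weighting [w] by
    [tent (a / r)], which is 1 for [a <= r] and 0 for [a >= 2 * r], makes the supremum [F]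
    nondecreasing and locally Lipschitz on [r > 0]. Smallness near 0 gives continuity there, and
    adding [r] gives strict growth, unboundedness and domination of the identity. *)
Lemma classKoo_majorant (O : R -> R -> Prop) :
  (forall a w, O a w -> 0 <= a) ->
  (forall r, exists B, forall a w, O a w -> a <= r -> w <= B) ->
  (forall e, 0 < e -> exists2 d, 0 < d & forall a w, O a w -> a <= d -> w <= e) ->
  exists rho, [/\ classKoo rho, forall a w, O a w -> w <= rho a
    & forall r, 0 <= r -> r <= rho r].
Proof.
move=> O0 Obnd Osmall.
pose A (r : R) := [set z | z = 0 \/ exists a w, O a w /\ z = Num.max 0 w * tent (a / r)].
have Abnd r B : 0 < r -> 0 <= B -> (forall a w, O a w -> a <= 2 * r -> w <= B) ->
    ubound (A r) B.
  move=> r0 B0 HB z [->//|[a [w [Oaw ->]]]].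
  have [ar|ra] := leP a (2 * r).
    apply: le_trans (_ : Num.max 0 w * 1 <= _).
      by apply: ler_wpM2l; [rewrite le_max lexx|exact: tent_le1].
    by rewrite mulr1 ge_max B0/= (HB a).
  by rewrite tent0 ?mulr0// ler_pdivlMr// ltW.
have ex_B r : exists2 B, 0 <= B & forall a w, O a w -> a <= r -> w <= B.
  have [B HB] := Obnd r; exists (Num.max 0 B); first by rewrite le_max lexx.
  by move=> a w Oaw ar; rewrite le_max (HB a w Oaw ar) orbT.
have supA r : 0 < r -> has_sup (A r).
  move=> r0; have [B B0 HB] := ex_B (2 * r).
  by split; [exists 0; left|exists B; exact: Abnd].
pose F r := if 0 < r then sup (A r) else 0.
have FE r : 0 < r -> F r = sup (A r) by rewrite /F => ->.
have F0 r : 0 <= F r.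
  rewrite /F; case: ifPn => // r0; apply: ub_le_sup; last by left.
  by case: (supA r r0).
have Fle r B : 0 <= B -> (forall a w, O a w -> a <= 2 * r -> w <= B) -> F r <= B.
  move=> B0 HB; rewrite /F; case: ifPn => // r0.
  by apply: ge_sup; [exists 0; left|exact: Abnd].
have Fmono r s : 0 <= r -> r <= s -> F r <= F s.
  rewrite (le_eqVlt 0) => /predU1P[<- _|r0 rs]; first by rewrite {1}/F ltxx F0.
  have s0 := lt_le_trans r0 rs.
  rewrite !FE//; apply: ge_sup; first by exists 0; left.
  move=> z [->|[a [w [Oaw ->]]]].
    by rewrite -FE.
  apply: (@le_trans _ _ (Num.max 0 w * tent (a / s))).
    apply: ler_wpM2l; first by rewrite le_max lexx.
    apply: tent_le; apply: ler_wpM2l; first exact: O0 Oaw.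
    by rewrite lef_pV2.
  by apply: ub_le_sup; [case: (supA s s0)|right; exists a, w].
(* Only [a <= 4 * r0] contribute, since [r <= 2 * r0]; for these [|a / r - a / s|] is at most
   [4 * r0 * |r - s| / (r0 / 2) ^ 2], whence the 16. *)
have Flip r0 B r s : 0 < r0 -> 0 <= B ->
    (forall a w, O a w -> a <= 4 * r0 -> w <= B) ->
    r0 / 2 <= r <= 2 * r0 -> r0 / 2 <= s <= 2 * r0 ->
    F r <= F s + B * (16 * `|r - s| / r0).
  move=> r00 B0 HB /andP[r1 r2] /andP[s1 s2].
  have rp : 0 < r by lra.
  have sp : 0 < s by lra.
  have K0 : 0 <= B * (16 * `|r - s| / r0).
    by rewrite mulr_ge0// divr_ge0 ?(ltW r00)// mulr_ge0.
  rewrite (FE r)//; apply: ge_sup; first by exists 0; left.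
  move=> z [->|[a [w [Oaw ->]]]]; first by have := F0 s; lra.
  have := O0 _ _ Oaw => a0.
  have [ar|ra] := leP a (4 * r0); last first.
    rewrite tent0; first by rewrite mulr0; have := F0 s; lra.
    by rewrite ler_pdivlMr//; lra.
  have w0 : 0 <= Num.max 0 w by rewrite le_max lexx.
  have wB : Num.max 0 w <= B by rewrite ge_max B0/= (HB a).
  have H1 : Num.max 0 w * tent (a / s) <= F s.
    by rewrite FE//; apply: ub_le_sup; [case: (supA s sp)|right; exists a, w].
  have H2 : tent (a / r) - tent (a / s) <= 16 * `|r - s| / r0.
    apply: le_trans (ler_norm _) _; apply: le_trans (tent_lip _ _) _.
    have -> : a / r - a / s = a * (s - r) / (r * s).
      by field; rewrite !gt_eqF.
    rewrite normrM normfV normrM (ger0_norm a0) (distrC s) (gtr0_norm (_ : 0 < r * s)) ?mulr_gt0//.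
    have rs : (r0 / 2) * (r0 / 2) <= r * s by apply: ler_pM => //; lra.
    rewrite ler_pdivrMr ?mulr_gt0//.
    have -> : 16 * `|r - s| / r0 * (r * s) = `|r - s| * (16 * (r * s) / r0).
      by ring.
    rewrite mulrC; apply: ler_wpM2l => //.
    rewrite ler_pdivlMr//; nra.
  have H3 : Num.max 0 w * (tent (a / r) - tent (a / s)) <= B * (16 * `|r - s| / r0).
    apply: (@le_trans _ _ (Num.max 0 w * (16 * `|r - s| / r0))).
      exact: ler_wpM2l.
    by apply: ler_wpM2r => //; rewrite divr_ge0 ?(ltW r00)// mulr_ge0.
  lra.
have Fsmall e : 0 < e -> exists2 d, 0 < d & forall r, r <= d -> F r <= e.
  move=> e0; have [d d0 Hd] := Osmall e e0.
  exists (d / 2); first by lra.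
  move=> r rd; apply: Fle; first exact: ltW.
  by move=> a w Oaw ar; apply: (Hd a) => //; lra.
have Fcont x : 0 <= x -> forall e : R, 0 < e -> exists2 d, 0 < d &
    forall y, 0 <= y -> `|y - x| < d -> `|F y - F x| < e.
  rewrite le_eqVlt => /predU1P[<-|x0] e e0.
    have e20 : 0 < e / 2 by lra.
    have [d d0 Hd] := Fsmall _ e20.
    exists d => // y y0; rewrite subr0 => yd.
    have -> : F 0 = 0 by rewrite /F ltxx.
    rewrite subr0 ger0_norm//; have yd' : y <= d by have := ler_norm y; lra.
    by have := Hd y yd'; lra.
  have [B B0 HB] := ex_B (4 * x).
  pose k := (B + 1) * 16 / x.
  have k0 : 0 < k by rewrite divr_gt0// mulr_gt0//; lra.
  exists (Num.min (x / 2) (e / k)).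
    by rewrite lt_min; apply/andP; split; apply: divr_gt0.
  move=> y y0; rewrite lt_min => /andP[y1 y2].
  have yx : x / 2 <= y <= 2 * x by move: y1; rewrite ltr_norml; lra.
  have xx : x / 2 <= x <= 2 * x by lra.
  have H1 := Flip x B y x x0 B0 HB yx xx.
  have H2 := Flip x B x y x0 B0 HB xx yx.
  have ke : k * `|y - x| < e by rewrite mulrC -ltr_pdivlMr.
  have kk : B * (16 * `|y - x| / x) <= k * `|y - x|.
    have -> : k * `|y - x| = (B + 1) * (16 * `|y - x| / x) by rewrite /k; ring.
    apply: ler_wpM2r; last lra.
    by apply: divr_ge0; [exact: mulr_ge0|exact: ltW].
  rewrite (distrC x y) in H2.
  rewrite ltr_norml; lra.
exists (fun r => F r + r); split.
- split; last first.
    move=> C; exists (`|C| + 1); first by have := normr_ge0 C; lra.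
    by have := F0 (`|C| + 1); have := ler_norm C; lra.
  split; last by move=> s t s0 st; have := Fmono s t s0 (ltW st); lra.
  split.
  + apply/continuous_classC0P => x x0 e e0.
    have e20 : 0 < e / 2 by lra.
    have [d d0 Hd] := Fcont x x0 _ e20.
    exists (Num.min d (e / 2)); first by rewrite lt_min d0.
    move=> y y0; rewrite lt_min => /andP[/(Hd y y0) + ].
    by rewrite !ltr_norml; lra.
  + by move=> s s0; have := F0 s; lra.
  + by rewrite /F ltxx addr0.
- move=> a w Oaw; have := O0 _ _ Oaw; rewrite le_eqVlt => /predU1P[a0|a0].
    rewrite -a0 /F ltxx addr0 leNgt; apply/negP => w0.
    have w20 : 0 < w / 2 by lra.
    have [d d0 Hd] := Osmall _ w20.
    have := Hd a w Oaw; lra.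
  have : w <= F a.
    rewrite FE//; apply: (@le_trans _ _ (Num.max 0 w * tent (a / a))).
      by rewrite divff ?gt_eqF// tent1 ?lexx// mulr1 le_max lexx orbT.
    by apply: ub_le_sup; [case: (supA a a0)|right; exists a, w].
  lra.
- by move=> r r0; have := F0 r; lra.
Qed.

(** The later estimates call for an upper bound of the inverse of [phi]. It comes from the pairs
    with [phi w <= y]: unboundedness of [phi] bounds [w] on bounded ranges of [y], and [phi e > 0]
    makes [w] small near 0. *)
Lemma classKoo_inv (phi : R -> R) : classKoo phi ->
  exists2 rho, classKoo rho & forall y w, 0 <= y -> 0 <= w -> phi w <= y -> w <= rho y.
Proof.
move=> [Kphi Uphi].
have [|||rho [Krho Hrho _]] :=
  @classKoo_majorant (fun y w => [/\ 0 <= y, 0 <= w & phi w <= y]).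
- by move=> a w [].
- move=> r; have [s s0 rs] := Uphi r; exists s => a w [_ w0 pw] ar.
  by apply: (classK_le_inv Kphi) => //; lra.
- move=> e e0; exists (phi e); first exact: classK_gt0.
  move=> a w [_ w0 pw] ar; apply: (classK_le_inv Kphi) => //; first exact: ltW.
  exact: le_trans ar.
exists rho => // y w y0 w0 pw; exact: Hrho.
Qed.

(** Compactness bounds [psi] on [[0, r]], and continuity with [psi 0 = 0] makes it small near 0.
    Domination of the identity makes the iterates of [rho] monotone in their number, which will be a
    number of impulses. *)
Lemma classP_majorant (psi : R -> R) : classP psi ->
  exists rho, [/\ classKoo rho, forall a, 0 <= a -> psi a <= rho a
    & forall a, 0 <= a -> a <= rho a].
Proof.
move=> [[cpsi psi0 psi00] psip].
have [|||rho [Krho Hrho Hid]] :=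
  @classKoo_majorant (fun a w => 0 <= a /\ w = psi a).
- by move=> a w [].
- move=> r; have [r0|r0] := ltP r 0.
    by exists 0 => a w [a0 _] ar; lra.
  have [|c c0r Hc] := @EVT_max R psi 0 r r0.
    apply: continuous_subspaceW cpsi => z /=; rewrite !in_itv/= => /andP[-> _]//.
  exists (psi c) => a w [a0 ->] ar; apply: Hc; rewrite in_itv/= a0//.
- move=> e e0; move/continuous_classC0P : cpsi => /(_ 0 (lexx _) e e0)[d d0 Hd].
  exists (d / 2); first lra.
  move=> a w [a0 ->] ad; have := Hd a a0; rewrite subr0 ger0_norm// psi00 subr0.
  by rewrite (ger0_norm (psi0 a a0)) => Hd'; apply/ltW/Hd'; lra.
exists rho; split => // a a0; exact: Hrho.
Qed.

End majorants.

Section KL.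
Variable R : realType.

(* In the supremum [D], the penalty [2 * pos (alpha a - y)] outweighs
   [w <= alpha a], which makes [D] finite; as a supremum of functions that are
   Lipschitz in [(y, s)], [D] is Lipschitz, whence the continuity of [beta]. *)
Lemma classKL_majorant (O : R -> R -> R -> Prop) (alpha : R -> R) :
  classKoo alpha ->
  (forall a b w, O a b w -> [/\ 0 <= a, 0 <= b & w <= alpha a]) ->
  (forall r e, 0 < e ->
     exists T, forall a b w, O a b w -> a <= r -> T <= b -> w <= e) ->
  exists2 beta, classKL beta & forall a b w, O a b w -> w <= beta a b.
Proof.
move=> [Ka Ua] Oal Oatt.
pose pos (x : R) := Num.max 0 x.
have posl x y : pos x <= pos y + `|x - y|.
  rewrite /pos; case: (leP 0 x); case: (leP 0 y);
    have := ler_norm (x - y); have := normr_ge0 (x - y); lra.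
have pos0 x : 0 <= pos x by rewrite le_max lexx.
have posx x : x <= pos x by rewrite le_max lexx orbT.
have posm x y : x <= y -> pos x <= pos y.
  by move=> xy; rewrite /pos; case: (leP 0 x); case: (leP 0 y); lra.
pose val a b w y s := w - pos (s - b) - 2 * pos (alpha a - y).
pose A y s := [set z | z = 0 \/ exists a b w, O a b w /\ z = val a b w y s].
have Aub y s : ubound (A y s) `|y|.
  move=> z [->//|[a [b [w [/Oal[a0 b0 wa] ->]]]]].
  have := classK_ge0 Ka a0; have := pos0 (s - b); have := pos0 (alpha a - y).
  have := posx (alpha a - y); have := ler_norm y; have := normr_ge0 y.
  rewrite /val; lra.
have supA y s : has_sup (A y s) by split; [exists 0; left|exists `|y|].
pose D y s := sup (A y s).
have D0 y s : 0 <= D y s by apply: ub_le_sup; [case: (supA y s)|left].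
have Dle y s B : 0 <= B -> (forall a b w, O a b w -> val a b w y s <= B) -> D y s <= B.
  move=> B0 HB; apply: ge_sup; first by exists 0; left.
  by move=> z [->//|[a [b [w [Oabw ->]]]]]; exact: HB.
have Dge a b w y s : O a b w -> val a b w y s <= D y s.
  by move=> Oabw; apply: ub_le_sup; [case: (supA y s)|right; exists a, b, w].
have Dlip y s y' s' : D y s <= D y' s' + (`|s - s'| + 2 * `|y - y'|).
  apply: Dle.
    by rewrite addr_ge0// addr_ge0// mulr_ge0.
  move=> a b w Oabw; have := Dge _ _ _ y' s' Oabw; rewrite /val.
  have := posl (s' - b) (s - b); have := posl (alpha a - y') (alpha a - y).
  have -> : s' - b - (s - b) = s' - s by ring.
  have -> : alpha a - y' - (alpha a - y) = y - y' by ring.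
  by rewrite (distrC s'); lra.
have Dmono y y' s s' : y <= y' -> s' <= s -> D y s <= D y' s'.
  move=> yy ss; apply: Dle => // a b w Oabw; have := Dge _ _ _ y' s' Oabw.
  have := posm (s' - b) (s - b); have := posm (alpha a - y') (alpha a - y).
  by rewrite /val; lra.
have D00 s : D 0 s = 0.
  apply/le_anti; rewrite D0 andbT; apply: Dle => // a b w /Oal[a0 b0 wa].
  have := classK_ge0 Ka a0; have := pos0 (s - b); have := posx (alpha a - 0).
  by rewrite /val; lra.
have Dlim y e : 0 <= y -> 0 < e -> exists S, forall s, S <= s -> D y s <= e.
  (* With [alpha r > 2 * y], any [a > r] has a penalty exceeding [alpha a]. For [a <= r], either
     [b >= T] and [w <= e], or the time penalty [s - b > alpha r] exceeds [w]. *)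
  move=> y0 e0; have [r r0 yr] := Ua (2 * y).
  have [T HT] := Oatt r e e0.
  exists (T + alpha r) => s Ts; apply: Dle; first exact: ltW.
  move=> a b w Oabw; have [a0 b0 wa] := Oal _ _ _ Oabw.
  have p1 := pos0 (s - b); have p2 := pos0 (alpha a - y).
  have p3 := posx (s - b); have p4 := posx (alpha a - y).
  have [ar|ra] := leP a r; last first.
    by have := classK_le Ka r0 (ltW ra); rewrite /val; lra.
  have [Tb|bT] := leP T b; first by have := HT _ _ _ Oabw ar Tb; rewrite /val; lra.
  by have := classK_le Ka a0 ar; rewrite /val; lra.
(* Extends [alpha] by 0 to the negative axis, so that continuity can be proved on the whole
   plane. *)
pose al r := alpha (Num.max 0 r).
have alE r : 0 <= r -> al r = alpha r by move=> r0; rewrite /al (max_idPr r0).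
have al_cont : continuous al.
  move=> x; apply/cvgrPdist_lt => e e0.
  have [[/continuous_classC0P ca _ _] _] := Ka.
  have [d d0 Hd] := ca (pos x) (pos0 x) e e0.
  apply/nbhs_ballP; exists d => //= y; rewrite /ball/= => xy.
  rewrite distrC; apply: Hd; first exact: pos0.
  apply: le_lt_trans xy; rewrite ler_norml -!/(pos _).
  by have := posl x y; have := posl y x; rewrite (distrC y x); lra.
(* [D] is only monotone; the exponential term supplies strict monotonicity in both arguments and
   preserves the limit 0 and the value 0 at [r = 0]. *)
pose beta r s := D (al r) s + al r * expR (- s).
exists beta; last first.
  move=> a b w Oabw; have [a0 b0 wa] := Oal _ _ _ Oabw.
  rewrite /beta alE//; have := Dge _ _ _ (alpha a) b Oabw.
  rewrite /val subrr subrr /pos maxxx.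
  have : 0 <= alpha a * expR (- b) by rewrite mulr_ge0 ?expR_ge0 ?classK_ge0.
  by lra.
have al0 r : 0 <= r -> 0 <= al r by move=> r0; rewrite alE// classK_ge0.
have Dcont : continuous (fun z : R * R => D z.1 z.2).
  move=> [y s]; apply/cvgrPdist_lt => e e0.
  have e40 : 0 < e / 4 by lra.
  exists (ball y (e / 4), ball s (e / 4)).
    by split; apply: nbhsx_ballx.
  move=> [y' s'] [/= yy ss]; rewrite /ball/= in yy ss.
  have := Dlip y s y' s'; have := Dlip y' s' y s.
  by rewrite (distrC y' y) (distrC s' s) ltr_norml; lra.
have bcont : continuous (fun z : R * R => beta z.1 z.2).
  move=> z; apply: cvgD.
    have h1 : (fun z : R * R => al z.1) @ z --> al z.1.
      by apply: (@continuous_comp _ _ _ fst al); [exact: cvg_fst|exact: al_cont].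
    exact: (cvg_comp2 (h := D) h1 cvg_snd (Dcont (al z.1, z.2))).
  apply: cvgM.
    apply: (@continuous_comp _ _ _ fst al); [exact: cvg_fst|exact: al_cont].
  apply: (@continuous_comp _ _ _ (fun z : R * R => - z.2) expR).
    apply: cvgN; exact: cvg_snd.
  exact: continuous_expR.
split.
- by apply: continuous_subspaceT => z; exact: bcont.
- move=> t t0; split; last first.
    move=> r s r0 rs; rewrite /beta !alE//; last lra.
    have ars := classK_lt Ka r0 rs.
    have := Dmono (alpha r) (alpha s) t t (ltW ars) (lexx _).
    have : alpha r * expR (- t) < alpha s * expR (- t) by rewrite ltr_pM2r ?expR_gt0.
    by lra.
  split.
  + apply: continuous_subspaceT => r.
    exact: (cvg_comp2 (h := beta) cvg_id (cvg_cst t) (bcont (r, t))).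
  + by move=> s s0; rewrite /beta addr_ge0// mulr_ge0 ?expR_ge0 ?al0.
  + by rewrite /beta alE// (classK0 Ka) D00 mul0r addr0.
- move=> r s t r0 s0 st; rewrite /beta alE// => bpos.
  have rp : 0 < r.
    rewrite lt_neqAle r0 andbT; apply/eqP => r00; move: bpos.
    by rewrite -r00 (classK0 Ka) D00 mul0r addr0 ltxx.
  have := classK_gt0 Ka rp; have := Dmono (alpha r) _ _ _ (lexx _) (ltW st) => D1 a0.
  have : alpha r * expR (- t) < alpha r * expR (- s).
    by rewrite ltr_pM2l// ltr_expR ltrN2.
  lra.
- move=> r r0; rewrite -[X in _ --> X]addr0; apply: cvgD.
    apply/cvgrPdist_le => e e0; have [S HS] := Dlim (al r) e (al0 _ r0) e0.
    near=> s; rewrite sub0r normrN ger0_norm//; apply: HS; near: s.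
    by apply: nbhs_pinfty_ge; rewrite num_real.
  rewrite -[X in _ --> X](mulr0 (al r)); apply: cvgM; first exact: cvg_cst.
  exact: cvgr_expR.
Unshelve. all: by end_near. Qed.

End KL.

(** * Absolutely continuous functions with nonpositive Dini derivative *)

Section absolutely_continuous.
Variables (R : realType) (n : nat).
Notation mu := (@lebesgue_measure R).

Lemma sum_disjoint_itv_le (U : set R) (N : nat) (c d : nat -> R) :
  measurable U ->
  (forall k, (k < N)%N -> c k <= d k /\ `]c k, d k[ `<=` U) ->
  trivIset `I_N (fun k => `]c k, d k[%classic) ->
  ((\sum_(k < N) (d k - c k))%:E <= mu U)%E.
Proof.
move=> mU cd triv.
have -> : (\sum_(k < N) (d k - c k))%:E
    = mu (\big[setU/set0]_(k < N) `]c k, d k[%classic).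
  rewrite (@measure_semi_additive_ord_I _ _ _ mu (fun k => `]c k, d k[%classic))//.
    rewrite -sumEFin; apply: eq_bigr => k _.
    have [ckdk _] := cd k (ltn_ord k).
    rewrite /= lebesgue_measure_itv/= lte_fin.
    by move: ckdk; rewrite le_eqVlt => /predU1P[->|->//]; rewrite ltxx subrr.
  by apply: bigsetU_measurable => k _.
apply: le_measure; rewrite ?inE//.
  by apply: bigsetU_measurable => k _.
rewrite -(bigcup_mkord N (fun k => `]c k, d k[%classic)) => t [k /= kN].
exact: (proj2 (cd k kN)).
Qed.

(* Off the null set, [y] creeps upward at rate at most [e]; inside an open
   neighbourhood [U] of the null set of small measure its growth is paid for by
   [A s], the variation over [U `&` [a, s]], which absolute continuity keeps
   small. *)
Lemma abs_continuous_dini_le (x : R -> 'rV[R]_n) (y : R -> R) (a b L : R) (E : set R) :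
  a <= b -> 0 <= L -> abs_continuous a b x ->
  (forall c d, a <= c -> c <= d -> d <= b ->
     `|y d - y c| <= L * ((d - c) + `|x d - x c|)) ->
  mu.-negligible E ->
  (forall s, a <= s -> s < b -> ~ E s -> forall e, 0 < e ->
     exists2 eta, 0 < eta & forall d, s < d -> d < s + eta -> d <= b ->
       y d - y s <= e * (d - s)) ->
  y b <= y a.
Proof.
move=> ab L0 acx ydom [Z [mZ Z0 EZ]] dini.
apply/ler_addgt0Pr => e e0.
(* The creep will cost [e1 * (b - a)] and the exceptional set [L * (2 * e1)]; the summand 1 makes
   [K] positive. *)
pose K := (b - a) + L * 2 + 1.
have K0 : 0 < K by rewrite /K; lra.
pose e1 := e / K.
have e10 : 0 < e1 by exact: divr_gt0.
have [del del0 Hdel] := acx e1 e10.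
pose eta := Num.min del e1.
have eta0 : 0 < eta by rewrite lt_min del0.
have muZ : (mu Z < +oo)%E by rewrite [mu Z]Z0.
have [U [oU ZU muUZ]] := lebesgue_regularity_outer mZ muZ eta0.
have mU : measurable U by exact: open_measurable.
have muU : (mu U < eta%:E)%E.
  have -> : U = (U `\` Z) `|` Z.
    by rewrite setUC setDUK.
  apply: (@le_lt_trans _ _ (mu (U `\` Z) + mu Z)%E).
    by apply: measureU2 => //; exact: measurableD.
  by rewrite [mu Z]Z0 adde0.
pose fam s N (c d : nat -> R) :=
  (forall k, (k < N)%N -> [/\ a <= c k, c k <= d k, d k <= s & `]c k, d k[ `<=` U])
  /\ trivIset `I_N (fun k => `]c k, d k[%classic).
pose S (N : nat) (c d : nat -> R) :=
  \sum_(k < N) ((d k - c k) + `|x (d k) - x (c k)|).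
have Sle s N c d : s <= b -> fam s N c d -> S N c d <= 2 * e1.
  move=> sb [H1 H2].
  have l1 : \sum_(k < N) (d k - c k) < eta.
    rewrite -lte_fin; apply: le_lt_trans muU; apply: sum_disjoint_itv_le => //.
    by move=> k /H1[].
  have l2 : \sum_(k < N) `|x (d k) - x (c k)| < e1.
    apply: Hdel => //; last by apply: lt_le_trans l1 _; rewrite ge_min lexx.
    by move=> k /H1[? ? ? _]; split=> //; exact: le_trans sb.
  rewrite /S big_split/=.
  have : eta <= e1 by rewrite ge_min lexx orbT.
  by lra.
pose A s := sup [set S N.1.1 N.1.2 N.2 | N in [set N | fam s N.1.1 N.1.2 N.2]].
have fam0 s : fam s 0%N (fun=> 0) (fun=> 0).
  by split => // i j /=; rewrite ltn0.
have nonempty s : [set S N.1.1 N.1.2 N.2 | N in [set N | fam s N.1.1 N.1.2 N.2]] 0.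
  by exists ((0%N, fun=> 0), fun=> 0); [exact: fam0|rewrite /S big_ord0].
have ubA s : s <= b ->
    ubound [set S N.1.1 N.1.2 N.2 | N in [set N | fam s N.1.1 N.1.2 N.2]] (2 * e1).
  by move=> sb _ [[[N c] d] /= HN <-]; exact: Sle HN.
have A_ge s N c d : s <= b -> fam s N c d -> S N c d <= A s.
  move=> sb HN; apply: ub_le_sup; first by exists (2 * e1); exact: ubA.
  by exists ((N, c), d).
have A_le s B : (forall N c d, fam s N c d -> S N c d <= B) -> A s <= B.
  move=> HB; apply: ge_sup; first by exists 0.
  by move=> _ [[[N c] d] /= HN <-]; exact: HB.
have A0 s : s <= b -> 0 <= A s.
  by move=> sb; have := A_ge s _ _ _ sb (fam0 s); rewrite /S big_ord0.
have Amono s t : s <= t -> t <= b -> A s <= A t.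
  move=> st tb; apply: A_le => N c d [H1 H2]; apply: A_ge => //; split=> //.
  by move=> k /H1[? ? ? ?]; split=> //; exact: le_trans st.
(* An open interval of [U] starting at [s] can be appended, as index [N], to every family inside
   [[a, s]]; this is how [A] pays for a step that starts in the null set. *)
have Aadd s t : a <= s -> s <= t -> t <= b -> `]s, t[ `<=` U ->
    A s + ((t - s) + `|x t - x s|) <= A t.
  move=> as_ st tb stU; rewrite -lerBrDr; apply: A_le => N c d [H1 H2].
  rewrite lerBrDr.
  pose c' k := if k == N then s else c k.
  pose d' k := if k == N then t else d k.
  have -> : S N c d + ((t - s) + `|x t - x s|) = S N.+1 c' d'.
    rewrite /S big_ord_recr/= /c' /d' eqxx; congr (_ + _).
    by apply: eq_bigr => k _; rewrite ltn_eqF.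
  apply: A_ge => //; split.
    move=> k; rewrite ltnS leq_eqVlt /c' /d' => /predU1P[->|kN].
      by rewrite eqxx; split.
    rewrite ltn_eqF//; have [? ? ? ?] := H1 k kN; split=> //; exact: le_trans st.
  apply/trivIsetP => i j /=; rewrite !ltnS => iN jN ij.
  wlog ilj : i j iN jN ij / (i < j)%N.
    move=> H; have [|ji|/eqP] := ltngtP i j; last by rewrite (negbTE ij).
      exact: H.
    by rewrite setIC; apply: H => //; rewrite eq_sym.
  have iN' : (i < N)%N by exact: leq_trans jN.
  rewrite /c' /d' (ltn_eqF iN').
  move: jN; rewrite leq_eqVlt => /predU1P[->|jN].
    rewrite eqxx; apply/seteqP; split => // r /=; rewrite !in_itv/=.
    have [_ _ ds _] := H1 i iN'.
    by case=> /andP[_ rd] /andP[sr _]; move: (lt_trans sr rd); lra.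
  rewrite ltn_eqF//; move/trivIsetP : H2; exact.
have ycont s : a < s -> s <= b -> forall e', 0 < e' -> exists2 r, a <= r < s &
    y s <= y r + e'.
  move=> as_ sb e' e'0.
  have L10 : 0 < L + 1 by lra.
  pose e2 := e' / (2 * (L + 1)).
  have e20 : 0 < e2 by rewrite divr_gt0// mulr_gt0.
  have [del2 del20 H] := acx e2 e20.
  pose r := Num.max a (s - Num.min del2 e2 / 2).
  have m0 : 0 < Num.min del2 e2 by rewrite lt_min del20.
  have rs : r < s by rewrite /r gt_max as_; move: m0; lra.
  have ar : a <= r by rewrite /r le_max lexx.
  have rm : s - Num.min del2 e2 / 2 <= r by rewrite /r le_max lexx orbT.
  have m1 : Num.min del2 e2 <= del2 by rewrite ge_min lexx.
  have m2 : Num.min del2 e2 <= e2 by rewrite ge_min lexx orbT.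
  exists r; first by rewrite ar.
  have := ydom r s ar (ltW rs) sb => yd.
  have xd : `|x s - x r| < e2.
    have := H 1%N (fun=> r) (fun=> s); rewrite !big_ord1; apply.
    - by move=> k _; split=> //; exact: ltW.
    - apply/trivIsetP => i j /=; rewrite !ltnS !leqn0 => /eqP -> /eqP ->.
      by rewrite eqxx.
    - by move: m0 m1 rm; lra.
  have : L * ((s - r) + `|x s - x r|) <= (L + 1) * (2 * e2).
    apply: ler_pM => //; first by rewrite addr_ge0// subr_ge0 ltW.
      by lra.
    by move: m0 m2 rm xd; lra.
  have -> : (L + 1) * (2 * e2) = e' by rewrite /e2; field; rewrite gt_eqF.
  by have := ler_norm (y s - y r); lra.
have : y b <= y a + e1 * (b - a) + L * A b.
  apply: (@real_induction R (fun s => y s <= y a + e1 * (s - a) + L * A s) a b) => //.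
  - by rewrite subrr mulr0 addr0 lerDl mulr_ge0// A0.
  - move=> s as_ sb IH.
    have [Es|nEs] := pselect (E s); last first.
      have [eta' eta'0 H] := dini s as_ sb nEs e1 e10.
      exists eta' => // d sd ds db.
      have := H d sd ds db.
      have : L * A s <= L * A d by apply: ler_wpM2l => //; exact: Amono (ltW sd) db.
      have -> : e1 * (d - a) = e1 * (s - a) + e1 * (d - s) by ring.
      by lra.
    have := oU s (ZU _ (EZ _ Es)) => /nbhs_ballP[r /= r0 Hr].
    exists r => // d sd ds db.
    have stU : `]s, d[ `<=` U.
      move=> t /=; rewrite in_itv/= => /andP[st td]; apply: Hr.
      rewrite /ball/= ltr_norml; lra.
    have H1 : L * (A s + (d - s + `|x d - x s|)) <= L * A d.
      by apply: ler_wpM2l => //; apply: Aadd => //; exact: ltW.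
    have H2 := ydom s d as_ (ltW sd) db; have := ler_norm (y d - y s).
    have : 0 <= e1 * (d - s) by apply: mulr_ge0; rewrite ?subr_ge0; exact: ltW.
    have -> : e1 * (d - a) = e1 * (s - a) + e1 * (d - s) by ring.
    by lra.
  - move=> s as_ sb IH; apply/ler_addgt0Pr => e' e'0.
    have [r /andP[ar rs] ysr] := ycont s as_ sb e' e'0.
    have := IH r ar rs.
    have : L * A r <= L * A s by apply: ler_wpM2l => //; exact: Amono (ltW rs) sb.
    have : e1 * (r - a) <= e1 * (s - a) by rewrite ler_pM2l//; lra.
    by lra.
have : L * A b <= L * (2 * e1).
  by apply: ler_wpM2l => //; apply: A_le => N c d; exact: Sle.
have : e1 * K = e by rewrite /e1; field; rewrite gt_eqF.
rewrite /K; have := e10; lra.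
Qed.

End absolutely_continuous.

(** * The energy transform and the flow integral *)

Section oriented_integral.
Variables (R : realType) (F : R -> R).
Hypothesis F_gt0 : forall x, 0 < x -> 0 < F x.
Hypothesis F_cont : forall x, 0 < x -> {for x, continuous F}.
Notation mu := (@lebesgue_measure R).

Lemma posfun_within_continuous a b : 0 < a -> {within `[a, b], continuous F}.
Proof.
move=> a0; apply: continuous_in_subspaceT => x; rewrite inE/= in_itv/= => /andP[ax _].
by apply: F_cont; exact: lt_le_trans ax.
Qed.

Lemma posfun_integrable a b : 0 < a -> mu.-integrable `[a, b] (EFin \o F).
Proof.
move=> a0; apply: continuous_compact_integrable; first exact: segment_compact.
exact: posfun_within_continuous.
Qed.

Let I a b := \int[mu]_(s in `[a, b]) F s.

Let I_add a b c : 0 < a -> a <= b -> b <= c -> I a c = I a b + I b c.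
Proof.
move=> a0 ab bc.
have := @Rintegral_itvB R F (BLeft a) (BRight c) b (posfun_integrable c a0).
rewrite !bnd_simp => /(_ ab bc) H.
rewrite /I addrC -(@Rintegral_itv_obnd_cbnd _ b (BRight c)) -?H ?subrK//.
apply: integrableS (posfun_integrable c a0) => //.
by apply: subset_itvr; rewrite bnd_simp.
Qed.

Lemma oriented_int_chasles a b c : 0 < a -> 0 < b -> 0 < c ->
  oriented_int F a c = oriented_int F a b + oriented_int F b c.
Proof.
move=> a0 b0 c0; rewrite /oriented_int -!/(I _ _).
case: (leP a c) => ac; case: (leP a b) => ab; case: (leP b c) => bc.
- exact: I_add.
- by have := I_add a0 ac (ltW bc); lra.
- by have := I_add b0 (ltW ab) ac; lra.
- lra.
- lra.
- by have := I_add c0 (ltW ac) ab; lra.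
- by have := I_add b0 bc (ltW ac); lra.
- by have := I_add c0 (ltW bc) (ltW ab); lra.
Qed.

Let I_bounds a b m M : 0 < a -> a <= b ->
  (forall s, a <= s -> s <= b -> m <= F s <= M) -> m * (b - a) <= I a b <= M * (b - a).
Proof.
move=> a0 ab mM.
have Icst r : \int[mu]_(s in `[a, b]) r = r * (b - a).
  rewrite Rintegral_cst//= lebesgue_measure_itv/= lte_fin.
  by move: ab; rewrite le_eqVlt => /predU1P[->|->//]; rewrite ltxx subrr.
have icst (r : R) : mu.-integrable `[a, b] (EFin \o (fun=> r)).
  apply: continuous_compact_integrable; first exact: segment_compact.
  by apply: continuous_subspaceT => x; exact: cvg_cst.
apply/andP; split; rewrite -Icst; apply: le_Rintegral => //;
  try exact: posfun_integrable; try exact: icst.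
- by move=> x /=; rewrite in_itv/= => /andP[ax xb]; case/andP: (mM x ax xb).
- by move=> x /=; rewrite in_itv/= => /andP[ax xb]; case/andP: (mM x ax xb).
Qed.

Lemma oriented_int_gt0 a b : 0 < a -> a < b -> 0 < oriented_int F a b.
Proof.
move=> a0 ab; rewrite /oriented_int (ltW ab).
have [c /[!in_itv]/= /andP[ac cb] Hc] :=
  EVT_min (ltW ab) (posfun_within_continuous (b := b) a0).
have [d _ Hd] := EVT_max (ltW ab) (posfun_within_continuous (b := b) a0).
have bnd s : a <= s -> s <= b -> F c <= F s <= F d.
  by move=> as_ sb; rewrite Hc ?Hd// in_itv/= as_.
have /andP[+ _] := I_bounds a0 (ltW ab) bnd.
apply: lt_le_trans; rewrite mulr_gt0 ?subr_gt0// F_gt0//; exact: lt_le_trans ac.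
Qed.

(* The primitive is strictly differentiable: both end points move. *)
Lemma oriented_int_strict_derive r e : 0 < r -> 0 < e ->
  exists2 eta, 0 < eta & forall x y, `|x - r| < eta -> `|y - r| < eta ->
    [/\ 0 < x, 0 < y & `|oriented_int F x y - F r * (y - x)| <= e * `|y - x|].
Proof.
move=> r0 e0.
have /cvgrPdist_lt/(_ e e0)/nbhs_ballP[d /= d0 Hd] := F_cont r0.
exists (Num.min d r); first by rewrite lt_min d0.
move=> x y; rewrite !lt_min => /andP[xd xr] /andP[yd yr].
have x0 : 0 < x by move: xr; rewrite ltr_norml; lra.
have y0 : 0 < y by move: yr; rewrite ltr_norml; lra.
split => //.
have main u v : 0 < u -> u <= v -> `|u - r| < d -> `|v - r| < d ->
    `|I u v - F r * (v - u)| <= e * (v - u).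
  move=> u0 uv ud vd.
  have bnd s : u <= s -> s <= v -> F r - e <= F s <= F r + e.
    move=> us sv; have := Hd s; rewrite /ball/= => H.
    have : `|r - s| < d by move: ud vd; rewrite !ltr_norml; lra.
    by move=> /H; rewrite ltr_norml; lra.
  have /andP[H1 H2] := I_bounds u0 uv bnd.
  by rewrite ler_norml; apply/andP; split; lra.
rewrite /oriented_int -!/(I _ _); case: (leP x y) => xy.
  have -> : `|y - x| = y - x by rewrite ger0_norm// subr_ge0.
  exact: main.
have -> : `|y - x| = x - y by rewrite ltr0_norm ?opprB// subr_lt0.
rewrite -normrN opprD opprK -mulrN opprB; apply: main => //; exact: ltW.
Qed.

End oriented_integral.

(** * Integrals for the completed measure and Borel minorants *)

Section completed_integral.
Import HBNNSimple.
Variable R : realType.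
Notation mu := (@lebesgue_measure R).
Notation cmu := (@completed_lebesgue_measure R).
Notation caraR := (caratheodory_type ((@wlength R idfun)^*)%mu).

Lemma borel_caratheodory (A : set R) : measurable (A : set (measurableTypeR R)) ->
  measurable (A : set caraR).
Proof. by move=> mA; exact: sub_caratheodory. Qed.

Lemma caratheodory_borel_null (A : set R) : measurable (A : set caraR) ->
  exists X Z : set R, [/\ measurable (X : set (measurableTypeR R)),
    measurable (Z : set (measurableTypeR R)), mu Z = 0 & A `\` Z = X `\` Z].
Proof.
move=> mA; have : (completed_algebra_gen mu).-sigma.-measurable A.
  by rewrite completed_caratheodory_measurable.
rewrite g_sigma_completed_algebra_genE => -[X mX [N [Z [mZ Z0 NZ]]] <-].
exists X, Z; split => //; rewrite setDUl.
apply/seteqP; split => [t [//|[/NZ + ?]//]|t Xt]; by left.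
Qed.

(** The identity map from the Lebesgue measurable to the Borel structure is measurable and pushes
    the completed measure forward to Lebesgue measure, so this is a change of variables. *)
Lemma ge0_integral_completed (D : set R) (f : R -> \bar R) :
  measurable (D : set (measurableTypeR R)) ->
  measurable_fun (setT : set (measurableTypeR R)) f -> (forall x, 0 <= f x)%E ->
  (\int[cmu]_(x in (D : set caraR)) f x = \int[mu]_(x in D) f x)%E.
Proof.
move=> mD mf f0.
have mid : measurable_fun (setT : set caraR) (id : caraR -> measurableTypeR R).
  by move=> _ B mB; rewrite setTI; exact: borel_caratheodory.
have mfD : measurable_fun (D : set (measurableTypeR R)) f by exact: measurable_funTS.
have f0D : {in D, forall y, (0 <= f y)%E} by move=> y _.
transitivity (\int[pushforward cmu (id : caraR -> measurableTypeR R)]_(x in D) f x)%E.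
  by rewrite (ge0_integral_pushforward mid).
exact: eq_measure_integral.
Qed.


Lemma integrable_bounded (q : R -> R) (K c d : R) :
  measurable_fun (setT : set (measurableTypeR R)) q ->
  (forall x, 0 <= q x <= K) -> mu.-integrable `]c, d] (EFin \o q).
Proof.
move=> mq qK; apply: measurable_bounded_integrable => //.
- rewrite /= lebesgue_measure_itv/= lte_fin; case: ifPn => // _; exact: ltry.
- exact: measurable_funTS.
- exists K; split; first exact: num_real.
  move=> x Kx y _ /=; have /andP[q0 qk] := qK y.
  by rewrite ger0_norm// (le_trans qk)// ltW.
Qed.

(* Replaces [p], measurable for the completed sigma-algebra only, by a Borel
   function to which the Lebesgue differentiation theorem applies; its
   boundedness makes the primitive Lipschitz. *)
Lemma exists_borel_minorant (p : R -> R) (c d e : R) : 0 < e ->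
  (forall x, c < x <= d -> 0 <= p x) ->
  cmu.-integrable (`]c, d]%classic : set caraR) (EFin \o p) ->
  exists (q : R -> R) (K : R),
    [/\ measurable_fun (setT : set (measurableTypeR R)) q,
        forall x, 0 <= q x <= K,
        forall x, c < x <= d -> q x <= p x
      & fine (\int[cmu]_(x in (`]c, d]%classic : set caraR)) (p x)%:E)%E
        <= \int[mu]_(x in `]c, d]) q x + e].
Proof.
move=> e0 p0 ip.
set D : set R := `]c, d]%classic.
have D0 x : D x -> (0 <= (p x)%:E)%E by rewrite /D/= in_itv/= lee_fin; exact: p0.
have mDb : measurable (D : set (measurableTypeR R)) by exact: measurable_itv.
have mD : measurable (D : set caraR) by exact: borel_caratheodory.
have fin : (\int[cmu]_(x in (D : set caraR)) (p x)%:E)%E \is a fin_num.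
  exact: integrable_fin_num ip.
have := fin; rewrite ge0_integralE// => fin'.
(* The integral is a supremum over simple functions, so some simple [h], below [p] on [D] and 0
   elsewhere, comes within [e]. Its finitely many values are listed without repetition in [s]. *)
have [_ [h /= hp <-] hs] := ub_ereal_sup_adherent e0 fin'.
have hD x : ~ D x -> h x = 0.
  move=> nD; apply/le_anti; rewrite fun_ge0 andbT.
  by have := hp x; rewrite patchE memNset// lee_fin.
have hple x : D x -> h x <= p x.
  by move=> Dx; have := hp x; rewrite patchE mem_set// lee_fin.
have /finite_seqP[s0 hs0] : finite_set (range h) by exact: fimfunP.
pose s := undup s0.
have hins t : h t \in s.
  rewrite mem_undup; have : range h (h t) by exists t.
  by rewrite hs0.
have /choice[XZ HXZ] (x : R) : exists XZ : set R * set R,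
    [/\ measurable (XZ.1 : set (measurableTypeR R)),
    measurable (XZ.2 : set (measurableTypeR R)), mu XZ.2 = 0 &
    h @^-1` [set x] `\` XZ.2 = XZ.1 `\` XZ.2].
  have [|X [Z H]] := @caratheodory_borel_null (h @^-1` [set x]).
    by rewrite -[X in measurable X]setTI; exact: measurable_funP.
  by exists (X, Z).
(* Each level set of [h] is Borel up to a null set, and [Z] collects these finitely many exceptions.
   The function [q] that is 0 on [Z] and equals [h] elsewhere is Borel and stays below [h]. *)
pose Z := \big[setU/set0]_(x <- s) (XZ x).2.
have mZ : measurable (Z : set (measurableTypeR R)).
  by apply: bigsetU_measurable => x _; case: (HXZ x).
have Z0 : mu Z = 0.
  rewrite /Z; elim: s {hins Z mZ} => [|x r IH]; first by rewrite big_nil measure0.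
  rewrite big_cons measureU0//; first by case: (HXZ x).
  - by case: (HXZ x).
  - by apply: bigsetU_measurable => y _; case: (HXZ y).
pose q t := \sum_(x <- s) x * \1_((XZ x).1 `\` Z) t.
have mq : measurable_fun (setT : set (measurableTypeR R)) q.
  apply: measurable_sum => x; apply: measurable_funM => //.
  by apply: measurable_indic; apply: measurableD => //; case: (HXZ x).
have qZ t : Z t -> q t = 0.
  move=> Zt; rewrite /q big1// => x _; rewrite indicE memNset ?mulr0//.
  by case.
have XE t x : ~ Z t -> x \in s -> (XZ x).1 t <-> h t = x.
  move=> nZ xs; have [_ _ _ E] := HXZ x.
  have nZx : ~ (XZ x).2 t.
    by move=> Zx; apply: nZ; rewrite /Z -bigcup_seq; exists x.
  split=> [Xt|htx].
    by have : ((XZ x).1 `\` (XZ x).2) t by []; rewrite -E => -[].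
  by have : (h @^-1` [set x] `\` (XZ x).2) t by []; rewrite E => -[].
have qh t : ~ Z t -> q t = h t.
  move=> nZ; rewrite /q (bigD1_seq (h t) (hins t))//= ?undup_uniq// big1_seq ?addr0.
    rewrite indicE mem_set ?mulr1//; split; first exact/(XE t (h t) nZ (hins t)).
    exact: nZ.
  by move=> x /andP[/eqP xh xs]; rewrite indicE memNset ?mulr0// => -[/(XE t x nZ xs)/esym].
have qle t : q t <= h t.
  by have [/qZ ->|/qh ->//] := pselect (Z t); exact: fun_ge0.
have q0 t : 0 <= q t.
  by have [/qZ ->//|/qh ->] := pselect (Z t); exact: fun_ge0.
pose K := \sum_(x <- s) `|x|.
have qK t : 0 <= q t <= K.
  rewrite q0/=; apply: le_trans (qle t) _.
  rewrite /K (bigD1_seq (h t) (hins t))//= ?undup_uniq//.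
  by rewrite (le_trans (ler_norm _))// lerDl sumr_ge0.
exists q, K; split => //.
  by move=> x xcd; apply: le_trans (qle x) (hple _ _); rewrite /D/= in_itv.
have iq := integrable_bounded c d mq qK.
have hq : (sintegral cmu h = \int[mu]_(x in D) (q x)%:E)%E.
  rewrite -integralT_nnsfun -ge0_integral_completed//; last exact/measurable_EFinP.
  rewrite [RHS]integral_mkcond.
  apply: ge0_ae_eq_integral.
  - exact: measurableT.
  - by apply/measurable_EFinP; exact: measurable_funP.
  - apply/(measurable_restrictT _ mD); apply/measurable_EFinP.
    apply: measurable_funTS; move=> _ B mB; rewrite setTI; apply: borel_caratheodory.
    by rewrite -[X in measurable X]setTI; exact: mq.
  - by move=> x _; rewrite lee_fin.
  - by move=> x _; rewrite patchE; case: ifP => // _; rewrite lee_fin.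
  exists Z; split; [exact: borel_caratheodory|exact: Z0|].
  move=> x /= nx; apply: contrapT => nZ; apply: nx => _.
  rewrite patchE; case: ifPn => [_|/negP xD]; first by rewrite qh.
  by rewrite hD// => Dx; apply: xD; rewrite inE.
have fq : (\int[mu]_(x in D) (q x)%:E)%E \is a fin_num by exact: integrable_fin_num iq.
have : ((fine (\int[cmu]_(x in (D : set caraR)) (p x)%:E) - e)%:E
    <= (\int[mu]_(x in D) q x)%:E)%E.
  by rewrite EFinB fineK// ge0_integralE// fineK// -hq; exact: ltW.
by rewrite lee_fin ge0_integralE// lerBlDr.
Qed.

End completed_integral.

Section derivative_estimate.
Variable R : realType.

Lemma is_derive_right_le (V : normedModType R) (x : R -> V) (s : R) (l : V) :
  is_derive s 1 x l -> forall e, 0 < e -> exists2 eta, 0 < eta &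
    forall h, 0 < h -> h < eta -> `|x (s + h) - x s - h *: l| <= e * h.
Proof.
move=> [dx <-] e e0.
have /cvgrPdist_le/(_ e e0) := dx.
rewrite /= => /nbhs_ballP[eta /= eta0 H].
exists eta => // h h0 heta.
have := H h; rewrite /ball/= sub0r normrN (gtr0_norm h0) => /(_ heta).
rewrite gt_eqF// => /(_ isT).
rewrite /shift/= scaler1 addrC [h + s]addrC => {}H.
have -> : x (s + h) - x s - h *: 'D_1 x s = - (h *: ('D_1 x s - h^-1 *: (x (s + h) - x s))).
  by rewrite scalerBr scalerA divff ?gt_eqF// scale1r opprB.
rewrite normrN normrZ gtr0_norm// mulrC ler_pM2r//.
by rewrite addrC.
Qed.

End derivative_estimate.

Section bounded_primitive.
Variables (R : realType) (q : R -> R) (K c : R).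
Notation mu := (@lebesgue_measure R).
Hypothesis mq : measurable_fun (setT : set (measurableTypeR R)) q.
Hypothesis qK : forall x, 0 <= q x <= K.

Let Q s := \int[mu]_(x in `]c, s]) q x.

Lemma bounded_primitive_lipschitz s t : c <= s -> s <= t ->
  0 <= Q t - Q s <= K * (t - s).
Proof.
move=> cs st; have int a b := integrable_bounded a b mq qK.
have -> : Q t - Q s = \int[mu]_(x in `]s, t]) q x.
  by apply: Rintegral_itvB; [exact: int|rewrite bnd_simp..].
apply/andP; split; first by apply: Rintegral_ge0 => x _; case/andP: (qK x).
have -> : K * (t - s) = \int[mu]_(x in `]s, t]) K.
  rewrite Rintegral_cst//= lebesgue_measure_itv/= lte_fin.
  by move: st; rewrite le_eqVlt => /predU1P[->|->//]; rewrite ltxx subrr.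
have K0 : 0 <= K by case/andP: (qK 0); exact: le_trans.
have intK : mu.-integrable `]s, t] (EFin \o (fun=> K)).
  by apply: (@integrable_bounded _ _ K) => // x; rewrite K0 lexx.
by apply: le_Rintegral (int s t) intK _ => // x _; case/andP: (qK x).
Qed.

Lemma bounded_primitive_derive :
  {ae mu, forall s, c < s -> is_derive s 1 Q (q s)}.
Proof.
have int a b := integrable_bounded a b mq qK.
have loc : locally_integrable setT q.
  split; [exact: mq|exact: openT|] => A _ cA.
  have mA : measurable (A : set (measurableTypeR R)) by exact: compact_measurable.
  suff /integrableP[_ //] : mu.-integrable A (EFin \o q).
  apply: measurable_bounded_integrable => //; first exact: compact_finite_measure.
    exact: measurable_funTS.
  exists K; split; first exact: num_real.
  move=> x Kx y _ /=; have /andP[q0 qk] := qK y.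
  by rewrite ger0_norm// (le_trans qk)// ltW.
have := @FTC1 R q (BRight c) (int c) loc.
apply: filterS; first exact: (ae_filter_ringOfSetsType mu).
move=> s H cs; have [dQ <-] := H cs.
by apply: DeriveDef; [exact: dQ|rewrite derive1E].
Qed.

End bounded_primitive.

Section flow_integral.
Variables (R : realType) (p : R -> R).
Notation cmu := (@completed_lebesgue_measure R).
Notation caraR := (caratheodory_type ((@wlength R idfun)^*)%mu).
Hypothesis p_ge0 : forall t, 0 <= t -> 0 <= p t.
Hypothesis p_int : loc_integrable p.

(** Left-open like the intervals in which impulses are counted, so that both parts of
    [energy_growth] are additive over adjacent intervals. *)
Definition itv_integral (c d : R) : R :=
  fine (\int[cmu]_(s in (`]c, d]%classic : set caraR)) (p s)%:E)%E.

Let mitv (i : interval R) : measurable ([set` i] : set caraR).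
Proof. by apply: borel_caratheodory; exact: measurable_itv. Qed.

Lemma loc_integrable_itv c d : 0 <= c ->
  cmu.-integrable (`]c, d]%classic : set caraR) (EFin \o p).
Proof.
move=> c0; have [dc|cd] := leP d c.
  rewrite set_itv_ge; last by rewrite bnd_simp -leNgt.
  exact: integrable_set0.
have d0 : 0 <= d by exact: le_trans (ltW cd).
apply: (integrableS (mitv _) (mitv _) _ (p_int d0)).
by apply: subset_itv; rewrite bnd_simp.
Qed.

Let itv_ge0 c d s : 0 <= c -> `]c, d]%classic s -> (0 <= (p s)%:E)%E.
Proof.
move=> c0 /=; rewrite in_itv/= lee_fin => /andP[cs _]; apply: p_ge0.
exact: le_trans c0 (ltW cs).
Qed.

Lemma itv_integral_ge0 c d : 0 <= c -> 0 <= itv_integral c d.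
Proof. by move=> c0; apply: fine_ge0; apply: integral_ge0 => s; exact: itv_ge0. Qed.

Lemma itv_integralD c d e : 0 <= c -> c <= d -> d <= e ->
  itv_integral c e = itv_integral c d + itv_integral d e.
Proof.
move=> c0 cd de; have d0 := le_trans c0 cd.
rewrite /itv_integral -fineD; last 2 first.
- by apply: integrable_fin_num => //; exact: loc_integrable_itv.
- by apply: integrable_fin_num => //; exact: loc_integrable_itv.
have cde : `]c, e]%classic = `]c, d]%classic `|` `]d, e]%classic :> set R.
  by rewrite -itv_bndbnd_setU// bnd_simp.
congr fine; rewrite -ge0_integral_setU.
- by rewrite -cde.
- exact: mitv.
- exact: mitv.
- rewrite -cde.
  by case/integrableP : (loc_integrable_itv e c0).
- by move=> s [|]; exact: itv_ge0.
- apply/disj_setPS => s [] /=; rewrite !in_itv/= => /andP[_ sd] /andP[ds _].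
  by move: (lt_le_trans ds sd); rewrite ltxx.
Qed.

(** The infimum runs over closed windows; removing the left end point, a null set, does not change
    the integral. *)
Lemma flow_inf_le theta t : 0 <= theta -> 0 <= t ->
  (flow_inf p theta <= (itv_integral t (t + theta))%:E)%E.
Proof.
move=> th0 t0; apply: (@le_trans _ _
    (\int[cmu]_(s in `[t, (t + theta)%R]) (p s)%:E)%E).
  by apply: ereal_inf_lbound; exists t => //=; rewrite in_itv/= t0.
rewrite fineK; last by apply: integrable_fin_num => //; exact: loc_integrable_itv.
have ip : cmu.-integrable (`[t, (t + theta)%R]%classic : set caraR) (EFin \o p).
  apply: (integrableS (mitv _) (mitv _) _ (p_int (_ : 0 <= t + theta))); last lra.
  by apply: subset_itv; rewrite bnd_simp.
rewrite (@ge0_negligible_integral _ caraR R cmu _ [set t]).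
- by rewrite setDitv1l.
- by rewrite -set_itv1; exact: mitv.
- exact: mitv.
- by case/integrableP : ip.
- move=> s /=; rewrite in_itv/= lee_fin => /andP[ts _]; apply: p_ge0.
  exact: le_trans ts.
- exact: lebesgue_measure_set1.
Qed.

End flow_integral.

(** * Impulse times *)

Section impulse_times.
Variable R : realType.
Implicit Types (gam : set R).

Lemma Gamma_finite gam T : Gamma gam -> finite_set (gam `&` [set s | s <= T]).
Proof.
move=> [[l _ ->]|[tau [_ _ cvg ->]]].
  exact: (sub_finite_set (@subIsetl _ _ _) (finite_seq l)).
have /cvgryPgt/(_ T) [N _ HN] := cvg.
apply: (@sub_finite_set _ _ (tau @` `I_N)); last exact/finite_image/finite_II.
move=> _ [[k _ <-] /= tkT]; exists k => //=; rewrite ltnNge; apply/negP => Nk.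
by have := HN k Nk; rewrite /= ltNge tkT.
Qed.

Lemma finite_isolated (A : set R) s : finite_set A ->
  exists2 eta, 0 < eta & forall r, A r -> r != s -> eta <= `|r - s|.
Proof.
move=> /finite_seqP[l ->]; elim: l => [|a l [eta eta0 H]]; first by exists 1.
have [->|as_] := eqVneq a s.
  exists eta => // r /=; rewrite in_cons => /predU1P[->|]; last exact: H.
  by rewrite eqxx.
exists (Num.min eta `|a - s|).
  by rewrite lt_min eta0 normr_gt0 subr_eq0.
move=> r /=; rewrite in_cons ge_min => /predU1P[->|rl rs].
  by rewrite lexx orbT.
by rewrite H.
Qed.

Lemma Gamma_isolated gam s : Gamma gam ->
  exists2 eta, 0 < eta & forall r, gam r -> r != s -> eta <= `|r - s|.
Proof.
move=> G; have [eta eta0 H] := finite_isolated s (Gamma_finite (s + 1) G).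
exists (Num.min eta 1); first by rewrite lt_min eta0 ltr01.
move=> r gr rs; rewrite ge_min; have [rs1|rs1] := leP r (s + 1).
  by rewrite H.
by apply/orP; right; have := ler_norm (r - s); lra.
Qed.

Lemma finite_last (A : set R) s : finite_set A -> 0 <= s ->
  exists tau, [/\ tau = 0 \/ A tau, 0 <= tau, tau <= s &
    forall r, A r -> r <= s -> r <= tau].
Proof.
move=> /finite_seqP[l ->] s0; elim: l => [|a l [tau [Htau tau0 taus H]]].
  by exists 0; split => //; left.
have [as_|sa] := leP a s; last first.
  exists tau; split=> //.
    by case: Htau => [|/= Hl]; [left|right; rewrite /= in_cons Hl orbT].
  move=> r /=; rewrite in_cons => /predU1P[->|]; last exact: H.
  by rewrite leNgt sa.
have [atau|taua] := leP a tau.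
  exists tau; split=> //.
    by case: Htau => [|/= Hl]; [left|right; rewrite /= in_cons Hl orbT].
  by move=> r /=; rewrite in_cons => /predU1P[->|]; last exact: H.
exists a; split => //.
- by right; rewrite /= in_cons eqxx.
- exact: le_trans tau0 (ltW taua).
- move=> r /=; rewrite in_cons => /predU1P[->//|rl rs].
  exact: le_trans (H r rl rs) (ltW taua).
Qed.

Lemma Gamma_last gam s : Gamma gam -> 0 <= s ->
  exists tau, [/\ tau = 0 \/ gam tau, 0 <= tau, tau <= s &
    forall r, gam r -> r <= s -> r <= tau].
Proof.
move=> G s0; have [tau [Htau tau0 taus H]] := finite_last (Gamma_finite s G) s0.
exists tau; split => //; first by case: Htau => [|[]]; [left|right].
by move=> r gr rs; apply: H.
Qed.

Lemma Gamma_itv_finite gam a b : Gamma gam -> finite_set (gam `&` `]a, b]).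
Proof.
move=> G; apply: sub_finite_set (Gamma_finite b G) => s [gs] /=.
by rewrite in_itv/= => /andP[].
Qed.

Lemma n_impD gam c d e : Gamma gam -> c <= d -> d <= e ->
  n_imp gam c e = (n_imp gam c d + n_imp gam d e)%N.
Proof.
move=> G cd de; rewrite /n_imp.
rewrite (@itv_bndbnd_setU _ _ (BRight c) (BRight d) (BRight e)) ?bnd_simp//.
rewrite setIUr fset_setU; [|exact: Gamma_itv_finite..].
rewrite cardfsU (_ : (_ `&` _)%fset = fset0) ?cardfs0 ?subn0//.
rewrite -fset_setI; [|exact: Gamma_itv_finite..].
rewrite (_ : _ `&` _ = set0) ?fset_set0//.
apply/seteqP; split => // s [[_ /= +] [_ /= +]]; rewrite !in_itv/=.
by move=> /andP[_ sd] /andP[ds _]; move: (lt_le_trans ds sd); rewrite ltxx.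
Qed.

Lemma n_imp_eq0 gam c d : (forall s, gam s -> c < s -> s <= d -> False) ->
  n_imp gam c d = 0%N.
Proof.
move=> H; rewrite /n_imp (_ : _ `&` _ = set0) ?fset_set0 ?cardfs0//.
apply/seteqP; split => // s [gs] /=; rewrite in_itv/= => /andP[]; exact: H.
Qed.

Lemma n_imp_eq1 gam c d s : gam s -> c < s <= d ->
  (forall r, gam r -> c < r -> r <= d -> r = s) -> n_imp gam c d = 1%N.
Proof.
move=> gs csd H; rewrite /n_imp (_ : _ `&` _ = [set s]) ?fset_set1 ?cardfs1//.
apply/seteqP; split => [r [gr] /=|r ->].
  by rewrite in_itv/= => /andP[cr rd]; exact: H.
by split => //=; rewrite in_itv.
Qed.

Lemma n_imp_le gam c d e : Gamma gam -> c <= d -> d <= e ->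
  (n_imp gam c d <= n_imp gam c e)%N.
Proof. by move=> G cd de; rewrite (n_impD G cd de) leq_addr. Qed.

End impulse_times.

(** * Lyapunov functions along solutions *)

Section lyapunov_along_solutions.
Variables (R : realType) (n m : nat).
Implicit Types (V : R -> 'rV[R]_n -> R) (t r k : R).

Lemma loc_lipschitz_ball V t (xi : 'rV[R]_n) : loc_lipschitz V -> 0 <= t ->
  exists r k, [/\ 0 < r, 0 < k &
    forall (t1 : R) (x1 : 'rV[R]_n) (t2 : R) (x2 : 'rV[R]_n), 0 <= t1 -> 0 <= t2 ->
    `|t1 - t| < r -> `|t2 - t| < r -> `|x1 - xi| < r -> `|x2 - xi| < r ->
    `|V t1 x1 - V t2 x2| <= k * (`|t1 - t2| + `|x1 - x2|)].
Proof.
move=> LV t0; have [U nU lipU] := LV t xi t0.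
have [r r0 rU] : exists2 r : R, 0 < r & forall t1 (x1 : 'rV[R]_n),
    `|t1 - t| < r -> `|x1 - xi| < r -> U (t1, x1).
  case: nU => -[A B] /= [/nbhs_ballP[r1 /= r10 HA] /nbhs_ballP[r2 /= r20 HB]] AB.
  exists (Num.min r1 r2); first by rewrite lt_min r10.
  move=> t1 x1; rewrite !lt_min => /andP[h1 _] /andP[_ h2]; apply: (AB (t1, x1)).
  split => /=; [apply: HA|apply: HB]; rewrite -ball_normE/= distrC //.
move: lipU => [M [_ HM]].
pose k := Num.max 1 (M + 1).
have k0 : 0 < k by rewrite lt_max ltr01.
exists r, k; split => // t1 x1 t2 x2 t10 t20 d1 d2 e1 e2.
have /HM/(_ ((t1, x1), (t2, x2))) H : M < k by rewrite lt_max; apply/orP; right; lra.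
apply: le_trans (H _) _ => /=.
  by split => /=; split => //; exact: rU.
apply: ler_wpM2l; first exact: ltW.
by rewrite ge_max/= lerDl lerDr !normr_ge0.
Qed.

Lemma upper_dini_le (f : R -> 'rV[R]_n -> 'rV[R]_m -> 'rV[R]_n)
    V t (xi : 'rV[R]_n) (mu : 'rV[R]_m) (l : R) :
  (upper_dini f V t xi mu <= l%:E)%E -> forall e, 0 < e ->
  exists2 eta, 0 < eta & forall h, 0 < h -> h < eta ->
    V (t + h) (xi + h *: f t xi mu) <= V t xi + (l + e) * h.
Proof.
move=> H e e0.
have /ereal_inf_lt[_ [A FA <-] Ale] : (upper_dini f V t xi mu < (l + e)%:E)%E.
  by apply: le_lt_trans H _; rewrite lte_fin; lra.
move: FA => /nbhs_ballP[eta /= eta0 Heta].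
exists eta => // h h0 heta.
have Ah : A h by apply: Heta => //; rewrite /ball/= sub0r normrN gtr0_norm.
have : (((V (t + h) (xi + h *: f t xi mu) - V t xi) / h)%:E < (l + e)%:E)%E.
  by apply: le_lt_trans Ale; apply: ereal_sup_ubound; exists h.
by rewrite lte_fin ltr_pdivrMr//; lra.
Qed.

(** The Dini derivative looks along the straight line in direction [f], which [x] leaves only by
    [o(h)]; local Lipschitz continuity of [V] turns this into an [o(h)] error in value. *)
Lemma lyapunov_right_dini (f : R -> 'rV[R]_n -> 'rV[R]_m -> 'rV[R]_n)
    V (x : R -> 'rV[R]_n) t mu (l : R) :
  loc_lipschitz V -> 0 <= t -> is_derive t 1 x (f t (x t) mu) ->
  (upper_dini f V t (x t) mu <= l%:E)%E -> forall e, 0 < e ->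
  exists2 eta, 0 < eta & forall h, 0 < h -> h < eta ->
    V (t + h) (x (t + h)) <= V t (x t) + (l + e) * h.
Proof.
move=> LV t0 dx dini e e0.
have e20 : 0 < e / 2 by lra.
have [eta1 eta10 H1] := upper_dini_le dini e20.
have [r [k [r0 k0 Hr]]] := loc_lipschitz_ball (x t) LV t0.
set v := f t (x t) mu in dx H1 *.
(* The bound [e / 2 / k] leaves an error of [e / 2 * h] after multiplication by the Lipschitz
   constant; the bound 1, with [h * B < r], keeps [x (t + h)] in the ball where [k] is valid. *)
pose e2 := Num.min 1 (e / 2 / k).
have e2_0 : 0 < e2 by rewrite lt_min ltr01/= divr_gt0.
have [eta2 eta20 H2] := is_derive_right_le dx e2_0.
pose B := `|v| + 2.
have B0 : 0 < B by rewrite /B; have := normr_ge0 v; lra.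
exists (Num.min (Num.min eta1 eta2) (Num.min r (r / B))).
  rewrite !lt_min eta10 eta20 r0/=; exact: divr_gt0.
move=> h h0; rewrite !lt_min => /andP[/andP[h1 h2] /andP[h3 h4]].
have hB : h * B < r by rewrite -ltr_pdivlMr.
have D2 := H2 h h0 h2.
have e21 : e2 <= 1 by rewrite ge_min lexx.
have e2k : k * e2 <= e / 2.
  by rewrite mulrC -ler_pdivlMr// ge_min lexx orbT.
have hv : `|h *: v| = h * `|v| by rewrite normrZ gtr0_norm.
have D3 : `|x (t + h) - (x t + h *: v)| <= e2 * h by rewrite opprD addrA.
have D4 : `|x t + h *: v - x t| < r.
  by rewrite addrC addKr hv; have := normr_ge0 v; move: hB; rewrite /B; nra.
have D5 : `|x (t + h) - x t| < r.
  have -> : x (t + h) - x t = (x (t + h) - x t - h *: v) + h *: v by rewrite subrK.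
  apply: le_lt_trans (ler_normD _ _) _; rewrite hv.
  by have := normr_ge0 v; move: hB; rewrite /B; nra.
have th : `|t + h - t| < r by rewrite addrC addKr gtr0_norm.
have th0 : 0 <= t + h by lra.
have := Hr _ _ _ _ th0 th0 th th D5 D4.
rewrite subrr normr0 add0r => D6.
have D7 : k * `|x (t + h) - (x t + h *: v)| <= e / 2 * h.
  apply: (@le_trans _ _ (k * (e2 * h))); first by apply: ler_wpM2l => //; exact: ltW.
  by rewrite mulrA; apply: ler_wpM2r => //; exact: ltW.
have := H1 h h0 h1; have := ler_norm (V (t + h) (x (t + h)) - V (t + h) (x t + h *: v)).
by rewrite !mulrDl; lra.
Qed.

Lemma abs_continuous_sub (x : R -> 'rV[R]_n) (a b c d : R) : abs_continuous a b x ->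
  a <= c -> d <= b -> abs_continuous c d x.
Proof.
move=> H ac db e e0; have [del del0 Hdel] := H e e0; exists del => // N cc dd Hcd.
apply: Hdel => k kN; have [? ? ?] := Hcd k kN; split=> //.
- exact: le_trans ac _.
- exact: le_trans db.
Qed.

Lemma abs_continuous_unif (x : R -> 'rV[R]_n) (a b : R) : abs_continuous a b x ->
  forall e, 0 < e -> exists2 d, 0 < d & forall s t,
    a <= s <= b -> a <= t <= b -> `|s - t| < d -> `|x s - x t| < e.
Proof.
move=> H e e0; have [del del0 Hdel] := H e e0; exists del => //.
have main s t : a <= s -> s <= t -> t <= b -> t - s < del -> `|x t - x s| < e.
  move=> as_ st tb d; have := Hdel 1%N (fun=> s) (fun=> t); rewrite !big_ord1; apply=> //.
  by move=> i j /=; rewrite !ltnS !leqn0 => /eqP -> /eqP ->.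
move=> s t /andP[as_ sb] /andP[at_ tb] std.
have [st|ts] := leP s t.
  rewrite distrC; apply: main => //.
  by move: std; rewrite distrC ger0_norm// subr_ge0.
by apply: main => //; [exact: ltW|move: std; rewrite gtr0_norm// subr_gt0].
Qed.

End lyapunov_along_solutions.

(** * Decay of the energy between impulses *)

Section flow.
Variables (R : realType) (n m : nat).
Variables (f : R -> 'rV[R]_n -> 'rV[R]_m -> 'rV[R]_n) (V : R -> 'rV[R]_n -> R).
Variables (p vphi : R -> R).
Hypothesis LV : loc_lipschitz V.
Hypothesis p_ge0 : forall t, 0 <= t -> 0 <= p t.
Hypothesis p_int : loc_integrable p.
Hypothesis Pphi : classP vphi.
Notation mu := (@lebesgue_measure R).
Let F (s : R) := (vphi s)^-1.

Lemma inv_classP_gt0 x : 0 < x -> 0 < F x.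
Proof. by case: Pphi => _ H x0; rewrite invr_gt0 H. Qed.

Lemma inv_classP_cont x : 0 < x -> {for x, continuous F}.
Proof.
move=> x0; have [[/continuous_classC0P c _ _] pos] := Pphi.
apply: cvgV; first by rewrite gt_eqF// pos.
apply/cvgrPdist_lt => e e0; have [d d0 Hd] := c x (ltW x0) e e0.
apply/nbhs_ballP; exists (Num.min d x) => /=; first by rewrite lt_min d0.
move=> y; rewrite /ball/= lt_min => /andP[yd yx].
rewrite distrC; apply: Hd; last by rewrite distrC.
by move: yx; rewrite ltr_norml; lra.
Qed.

(** The [Phi] of the overview, based at 1. It has a meaning for positive arguments only, since
    [1 / vphi] may fail to be integrable at 0. *)
Definition energy (r : R) := oriented_int (fun s => (vphi s)^-1) 1 r.

Lemma energyB a b : 0 < a -> 0 < b -> energy b - energy a = oriented_int F a b.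
Proof.
move=> a0 b0; rewrite /energy.
rewrite (oriented_int_chasles inv_classP_cont ltr01 a0 b0).
by rewrite addrAC subrr add0r.
Qed.

Lemma energy_lt a b : 0 < a -> a < b -> energy a < energy b.
Proof.
move=> a0 ab; rewrite -subr_gt0 energyB//; last exact: lt_trans ab.
exact: (oriented_int_gt0 inv_classP_gt0 inv_classP_cont).
Qed.

Lemma energy_le a b : 0 < a -> a <= b -> energy a <= energy b.
Proof. by move=> a0; rewrite le_eqVlt => /predU1P[->//|/(energy_lt a0)/ltW]. Qed.

Lemma energy_le_inv a b : 0 < a -> 0 < b -> energy a <= energy b -> a <= b.
Proof. by move=> a0 b0; apply: contraTT; rewrite -!ltNge; exact: energy_lt. Qed.

Lemma energy_strict_derive r e : 0 < r -> 0 < e ->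
  exists2 eta, 0 < eta & forall x y, `|x - r| < eta -> `|y - r| < eta ->
    [/\ 0 < x, 0 < y & `|energy y - energy x - F r * (y - x)| <= e * `|y - x|].
Proof.
move=> r0 e0.
have [eta eta0 H] := oriented_int_strict_derive inv_classP_cont r0 e0.
exists eta => // x y xr yr; have [x0 y0] := H x y xr yr.
by rewrite energyB.
Qed.

Lemma energy_continuous r : 0 < r -> {for r, continuous energy}.
Proof.
move=> r0; apply/cvgrPdist_lt => e e0.
have [eta eta0 H] := energy_strict_derive r0 (@ltr01 R).
have F0 := inv_classP_gt0 r0.
apply/nbhs_ballP; exists (Num.min eta (e / (F r + 1))) => /=.
  by rewrite lt_min eta0/=; apply: divr_gt0 => //; lra.
move=> y; rewrite /ball/= lt_min => /andP[ry1 ry2].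
have rr : `|r - r| < eta by rewrite subrr normr0.
have yr : `|y - r| < eta by rewrite distrC.
have [_ _ D] := H y r yr rr.
have : `|energy r - energy y| <= (F r + 1) * `|r - y|.
  have -> : energy r - energy y = (energy r - energy y - F r * (r - y)) + F r * (r - y).
    by rewrite subrK.
  apply: le_trans (ler_normD _ _) _.
  by rewrite normrM (gtr0_norm F0) mulrDl mul1r; lra.
move=> /le_lt_trans; apply; rewrite mulrC -ltr_pdivlMr//; lra.
Qed.

(** A chain rule for Dini derivatives. As the primitive is increasing, it may be applied to the
    upper bound [v + k * h] of the value; along this straight path its derivative [1 / vphi v]
    cancels the factor [vphi v] of the decay rate. *)
Lemma energy_right_dini (x : R -> 'rV[R]_n) t u l e :
  0 <= t -> 0 < V t (x t) -> is_derive t 1 x (f t (x t) u) ->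
  (upper_dini f V t (x t) u <= (- (l * vphi (V t (x t))))%:E)%E -> 0 < e ->
  exists2 eta, 0 < eta & forall h, 0 < h -> h < eta ->
    0 < V (t + h) (x (t + h)) ->
    energy (V (t + h) (x (t + h))) <= energy (V t (x t)) + (- l + e) * h.
Proof.
move=> t0 v0 dx dini e0; set v := V t (x t) in v0 dini *.
have phi0 : 0 < vphi v by case: Pphi => _; apply.
have F0 := inv_classP_gt0 v0.
(* Multiplied by [F v = 1 / vphi v] this contributes [e / 2]; [e3] spends the other half on the
   linearization error. *)
pose e1 := e * vphi v / 2.
have e10 : 0 < e1 by rewrite divr_gt0// mulr_gt0.
have [eta1 eta10 H1] := lyapunov_right_dini LV t0 dx dini e10.
rewrite -/v in H1.
pose k := - (l * vphi v) + e1.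
pose e3 := e / (2 * (`|k| + 1)).
have k10 : 0 < `|k| + 1 by have := normr_ge0 k; lra.
have e30 : 0 < e3 by rewrite divr_gt0// mulr_gt0.
have [eta3 eta30 H3] := energy_strict_derive v0 e30.
exists (Num.min eta1 (eta3 / (`|k| + 1))).
  by rewrite lt_min eta10/=; exact: divr_gt0.
move=> h h0; rewrite lt_min => /andP[h1 h3] vh0.
have hk : `|v + k * h - v| < eta3.
  rewrite addrC addKr normrM (gtr0_norm h0).
  move: h3; rewrite ltr_pdivlMr//; apply: le_lt_trans.
  by rewrite mulrC; apply: ler_wpM2l; [exact: ltW|lra].
have vv : `|v - v| < eta3 by rewrite subrr normr0.
have [_ vkh0 D] := H3 _ _ vv hk.
have le1 := H1 h h0 h1.
have := energy_le vh0 le1.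
rewrite -/k in le1 *.
have Ek : `|v + k * h - v| = `|k| * h by rewrite addrC addKr normrM (gtr0_norm h0).
rewrite Ek in D.
have Fk : F v * (v + k * h - v) = (- l + e / 2) * h.
  rewrite addrAC subrr add0r /k /e1 /F; field; rewrite gt_eqF//.
rewrite Fk in D.
have e3k : e3 * (`|k| * h) <= e / 2 * h.
  rewrite mulrA; apply: ler_wpM2r; first exact: ltW.
  have -> : e / 2 = e3 * (`|k| + 1).
    by rewrite /e3; field; rewrite gt_eqF//.
  by apply: ler_wpM2l; [exact: ltW|lra].
have := ler_norm (energy (v + k * h) - energy v - (- l + e / 2) * h).
by rewrite !mulrDl in D Fk *; move: D e3k; clear -f F LV p_ge0 p_int Pphi; lra.
Qed.

Section bounded_rate.
Variables (q : R -> R) (K : R).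
Hypothesis mq : measurable_fun (setT : set (measurableTypeR R)) q.
Hypothesis qK : forall x, 0 <= q x <= K.

(** The energy plus the primitive of [q] is dominated by time plus the variation of [x], and off a
    null set its right Dini derivative is at most [q t - p t <= 0]. Lipschitz constants are local,
    so monotonicity is proved near each time and glued. *)
Lemma energy_flow_bounded (x : R -> 'rV[R]_n) (u : R -> 'rV[R]_m) (a b : R) :
  0 <= a -> a <= b -> abs_continuous a b x ->
  (forall t, a <= t <= b -> 0 < V t (x t)) ->
  (forall t, a < t <= b -> q t <= p t) ->
  {ae mu, forall t, a < t < b -> is_derive t 1 x (f t (x t) (u t)) /\
     (upper_dini f V t (x t) (u t) <= (- (p t * vphi (V t (x t))))%:E)%E} ->
  energy (V b (x b)) + \int[mu]_(t in `]a, b]) q t <= energy (V a (x a)).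
Proof.
move=> a0 ab acx vpos qp aeH.
pose Q s := \int[mu]_(t in `]a, s]) q t.
pose Y s := energy (V s (x s)) + Q s.
have Ya : Y a = energy (V a (x a)).
  by rewrite /Y /Q set_itv_ge ?bnd_simp ?ltxx// Rintegral_set0 addr0.
rewrite -Ya -/(Y b).
have aeQ := bounded_primitive_derive a mq qK.
have K0 : 0 <= K by case/andP: (qK 0); exact: le_trans.
pose E := [set t | ~ ((a < t < b -> is_derive t 1 x (f t (x t) (u t)) /\
     (upper_dini f V t (x t) (u t) <= (- (p t * vphi (V t (x t))))%:E)%E) /\
     (a < t -> is_derive t 1 Q (q t)))].
(* The derivative of [Q] is known for [t > a] only, so [a] joins the exceptional set. *)
have negE : mu.-negligible (E `|` [set a]).
  apply: negligibleU; first exact: (@filterI _ _ (ae_filter_ringOfSetsType mu) _ _ aeH aeQ).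
  by exists [set a]; split => //; exact: lebesgue_measure_set1.
apply: (@local_to_global R (fun c d => Y d <= Y c) a b) => //.
  by move=> c d e _ _ _ _ h1 h2; exact: le_trans h2 h1.
move=> s as_ sb.
have s0 : 0 <= s by exact: le_trans as_.
have v0 : 0 < V s (x s) by apply: vpos; rewrite as_.
have [r [k [r0 k0 Hr]]] := loc_lipschitz_ball (x s) LV s0.
have [eta2 eta20 H2] := energy_strict_derive v0 (@ltr01 R).
pose rho := Num.min r (eta2 / (2 * k)).
have rho0 : 0 < rho by rewrite lt_min r0/= divr_gt0// mulr_gt0.
have rho1 : rho <= r by rewrite ge_min lexx.
have rho2 : k * (2 * rho) <= eta2.
  have : rho <= eta2 / (2 * k) by rewrite ge_min lexx orbT.
  by rewrite ler_pdivlMr ?mulr_gt0//; lra.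
have [del del0 Hdel] := abs_continuous_unif acx rho0.
(* Near [s] the primitive has slope at most [F (V s (x s)) + 1], by strict differentiability with
   tolerance 1; [V] contributes the factor [k], and [Q] the summand [K]. *)
pose L := (F (V s (x s)) + 1) * k + K.
have Fs0 := inv_classP_gt0 v0.
have L0 : 0 <= L by rewrite addr_ge0// mulr_ge0 ?(ltW k0)// addr_ge0// ltW.
exists (Num.min del rho); first by rewrite lt_min del0.
move=> c d ac cs sd db sc ds.
have m1 : Num.min del rho <= del by rewrite ge_min lexx.
have m2 : Num.min del rho <= rho by rewrite ge_min lexx orbT.
have near_s t : c <= t -> t <= d -> `|t - s| < Num.min del rho.
  move=> ct td; rewrite ltr_norml; move: sc ds ct td; clear -f F LV p_ge0 p_int Pphi mq qK => *.
  by apply/andP; split; lra.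
have inab t : c <= t -> t <= d -> a <= t <= b.
  by move=> ct td; rewrite (le_trans ac ct) (le_trans td db).
have sin : a <= s <= b by rewrite as_.
have xnear t : c <= t -> t <= d -> `|x t - x s| < rho.
  move=> ct td; apply: Hdel; [exact: inab|by []|].
  exact: lt_le_trans (near_s t ct td) m1.
have t_ge0 t : c <= t -> 0 <= t by move=> ct; apply: le_trans ct; exact: le_trans ac.
have vlip t1 t2 : c <= t1 <= d -> c <= t2 <= d ->
    `|V t1 (x t1) - V t2 (x t2)| <= k * (`|t1 - t2| + `|x t1 - x t2|).
  move=> /andP[ct1 td1] /andP[ct2 td2]; apply: Hr; rewrite ?t_ge0//;
    apply: lt_le_trans rho1.
  - exact: lt_le_trans (near_s _ ct1 td1) m2.
  - exact: lt_le_trans (near_s _ ct2 td2) m2.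
  - exact: xnear.
  - exact: xnear.
have vnear t : c <= t -> t <= d -> `|V t (x t) - V s (x s)| < eta2.
  move=> ct td; apply: le_lt_trans (vlip t s _ _) _; rewrite ?ct ?cs//.
  apply: lt_le_trans rho2; rewrite ltr_pM2l//.
  by have := near_s t ct td; have := xnear t ct td; move: m2; clear -f F LV p_ge0 p_int Pphi mq qK; lra.
apply: (@abs_continuous_dini_le R n x Y c d L (E `|` [set a])) => //.
- exact: le_trans cs sd.
- exact: abs_continuous_sub acx ac db.
- move=> c1 d1 cc1 cd1 dd1.
  have c1d := le_trans cd1 dd1; have cd1' := le_trans cc1 cd1.
  have [_ _ D] := H2 _ _ (vnear _ cc1 c1d) (vnear _ cd1' dd1).
  have := vlip d1 c1; rewrite cc1 c1d cd1' dd1 => /(_ isT isT).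
  set dv := V d1 (x d1) - V c1 (x c1) in D *.
  rewrite (ger0_norm (_ : 0 <= d1 - c1)) ?subr_ge0// => D2.
  have /andP[Q1 Q2] := bounded_primitive_lipschitz mq qK (le_trans ac cc1) cd1.
  rewrite -/(Q _) -/(Q _) in Q1 Q2.
  have D3 : `|energy (V d1 (x d1)) - energy (V c1 (x c1))| <=
      (F (V s (x s)) + 1) * (k * (d1 - c1 + `|x d1 - x c1|)).
    apply: (@le_trans _ _ ((F (V s (x s)) + 1) * `|dv|)); last first.
      by apply: ler_wpM2l => //; rewrite addr_ge0// ltW.
    rewrite -[X in `|X|](subrK (F (V s (x s)) * dv)).
    apply: le_trans (ler_normD _ _) _.
    by rewrite normrM (gtr0_norm Fs0) mulrDl mul1r addrC lerD2l; rewrite mul1r in D.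
  rewrite /Y /L opprD addrACA; apply: le_trans (ler_normD _ _) _.
  rewrite (ger0_norm Q1) [leRHS]mulrDl -mulrA; apply: lerD => //.
  apply: le_trans Q2 _; apply: ler_wpM2l => //.
  by rewrite lerDl.
- move=> t ct td nE e e0.
  have [Hx HQ] : (a < t < b -> is_derive t 1 x (f t (x t) (u t)) /\
     (upper_dini f V t (x t) (u t) <= (- (p t * vphi (V t (x t))))%:E)%E) /\
     (a < t -> is_derive t 1 Q (q t)).
    by apply: contrapT => H; apply: nE; left.
  have at_ : a < t.
    rewrite lt_neqAle (le_trans ac ct) andbT; apply/eqP => ta.
    by apply: nE; right.
  have tb : t < b by exact: lt_le_trans db.
  have [|dx dini] := Hx; first by rewrite at_.
  have e20 : 0 < e / 2 by exact: divr_gt0.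
  have tv0 : 0 < V t (x t) by apply: vpos; rewrite !ltW.
  have [eta eta0 H] := energy_right_dini (ltW (le_lt_trans a0 at_)) tv0 dx dini e20.
  have [eta' eta'0 H'] := is_derive_right_le (HQ at_) e20.
  exists (Num.min eta eta'); first by rewrite lt_min eta0.
  move=> d1 td1 d1eta d1d; pose h := d1 - t.
  have d1E : d1 = t + h by rewrite /h addrC subrK.
  have h0 : 0 < h by rewrite subr_gt0.
  have := d1eta; rewrite -ltrBlDl -/h lt_min => /andP[h1 h2].
  have pd1 : 0 < V d1 (x d1).
    by apply: vpos; rewrite (ltW (lt_trans at_ td1)) (le_trans d1d).
  rewrite d1E in pd1 *.
  have := H h h0 h1 pd1.
  have : Q (t + h) - Q t - h * q t <= e / 2 * h.
    exact: le_trans (ler_norm _) (H' h h0 h2).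
  have qpt : h * q t <= h * p t.
    by apply: ler_wpM2l; [exact: ltW|apply: qp; rewrite at_ ltW].
  by rewrite /Y; move: qpt; clear -f F LV p_ge0 p_int Pphi mq qK; lra.
Qed.

End bounded_rate.

(** The end [s] may be an impulse time, where only the left limit [w] is controlled; so the bounded
    estimate is used on [[a, c]] with [c] close to [s]. The slack [e] pays [e / 2] for the Borel
    minorant of [p], [e / 4] for continuity of the energy at [w], and [e / 4] for the integral of
    [q] over []c, s]]. *)
Lemma energy_flow (x : R -> 'rV[R]_n) (u : R -> 'rV[R]_m) (a s w : R) :
  0 <= a -> a < s -> (forall c, a <= c -> c < s -> abs_continuous a c x) ->
  (forall t, a <= t -> t < s -> 0 < V t (x t)) ->
  {ae mu, forall t, a < t < s -> is_derive t 1 x (f t (x t) (u t)) /\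
     (upper_dini f V t (x t) (u t) <= (- (p t * vphi (V t (x t))))%:E)%E} ->
  V t (x t) @[t --> s^'-] --> w -> 0 < w ->
  energy w + itv_integral p a s <= energy (V a (x a)).
Proof.
move=> a0 as_ acx vpos aeH vw w0; apply/ler_addgt0Pr => e e0.
have e20 : 0 < e / 2 by lra.
have pcd t : a < t <= s -> 0 <= p t.
  by move=> /andP[/ltW at_ _]; apply: p_ge0; exact: le_trans at_.
have [q [K [mq qK qp pq]]] :=
  exists_borel_minorant e20 pcd (loc_integrable_itv p_int s a0).
have K0 : 0 <= K by case/andP: (qK 0); exact: le_trans.
have K10 : 0 < K + 1 by lra.
have cvgE : energy (V t (x t)) @[t --> s^'-] --> energy w.
  exact: (continuous_cvg _ (energy_continuous w0) vw).
have e40 : 0 < e / 4 by lra.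
have /cvgrPdist_lt/(_ _ e40) := cvgE.
move=> /nbhs_ballP[d /= d0 Hd].
pose mn := Num.min d (e / 4 / (K + 1)).
have mn0 : 0 < mn by rewrite lt_min d0/= divr_gt0.
have mn1 : mn <= d by rewrite ge_min lexx.
have mn2 : K * mn <= e / 4.
  apply: (@le_trans _ _ ((K + 1) * mn)); first by apply: ler_wpM2r; [exact: ltW|lra].
  by rewrite mulrC -ler_pdivlMr// ge_min lexx orbT.
pose c := Num.max a (s - mn / 2).
have ac : a <= c by rewrite le_max lexx.
have cs : c < s by rewrite gt_max as_/=; lra.
have smc : s - c < mn.
  have : s - mn / 2 <= c by rewrite le_max lexx orbT.
  by lra.
have H1 : energy (V c (x c)) + \int[mu]_(t in `]a, c]) q t <= energy (V a (x a)).
  apply: (@energy_flow_bounded q K mq qK x u a c) => //.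
  - exact: acx.
  - by move=> t /andP[at_ tc]; apply: vpos => //; exact: le_lt_trans cs.
  - by move=> t /andP[at_ tc]; apply: qp; rewrite at_/= (le_trans tc)// ltW.
  - apply: filterS aeH; first exact: (ae_filter_ringOfSetsType mu).
    by move=> t H /andP[at_ tc]; apply: H; rewrite at_ (lt_trans tc).
have H2 := bounded_primitive_lipschitz mq qK ac (ltW cs).
have H3 : `|energy w - energy (V c (x c))| < e / 4.
  apply: Hd => //; rewrite /ball/= gtr0_norm ?subr_gt0//.
  exact: lt_le_trans mn1.
move: H2 => /andP[_ H2].
have H4 : K * (s - c) <= e / 4.
  by apply: le_trans mn2; apply: ler_wpM2l => //; exact: ltW.
have H5 := ler_norm (energy w - energy (V c (x c))).
rewrite -/(itv_integral p a s) in pq.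
by move: H1 H2 H3 H4 H5 pq; clear -f F LV p_ge0 p_int Pphi; lra.
Qed.

End flow.

(** * Trajectories: decrease or reset *)

Section trajectory.
Variables (R : realType) (n m : nat).
Variables (f g : R -> 'rV[R]_n -> 'rV[R]_m -> 'rV[R]_n) (V : R -> 'rV[R]_n -> R).
Variables (chi pi p vphi psi kap : R -> R) (M : R).
Hypothesis LV : loc_lipschitz V.
Hypothesis V_ge0 : forall t xi, 0 <= t -> 0 <= V t xi.
Hypothesis p_ge0 : forall t, 0 <= t -> 0 <= p t.
Hypothesis p_int : loc_integrable p.
Hypothesis Pphi : classP vphi.
Hypothesis Kchi : classKoo chi.
Hypothesis Kpi : classKoo pi.
Hypothesis Kkap : classKoo kap.
Hypothesis psi_kap : forall a, 0 <= a -> psi a <= kap a.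
Hypothesis flowV : forall (t : R) xi mu, 0 <= t -> chi (enorm mu) <= V t xi ->
  (upper_dini f V t xi mu <= (- (p t * vphi (V t xi)))%:E)%E.
Hypothesis jumpV : forall (t : R) xi mu, 0 <= t -> chi (enorm mu) <= V t xi ->
  V t (xi + g t xi mu) <= psi (V t xi).
Hypothesis jump_smallV : forall (t : R) xi mu, 0 <= t -> V t xi <= chi (enorm mu) ->
  V t (xi + g t xi mu) <= pi (enorm mu).
Hypothesis jumpM : forall a, 0 < a ->
  oriented_int (fun s => (vphi s)^-1) a (psi a) <= M.
Notation mu := (@lebesgue_measure R).

Definition energy_growth gam (c d : R) : R :=
  M * (n_imp gam c d)%:R - itv_integral p c d.

Variables (t0 t1 b : R) (x0 : 'rV[R]_n) (u : R -> 'rV[R]_m) (gam : set R).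
Variables (x : R -> 'rV[R]_n) (T : \bar R).
Hypothesis t0_ge0 : 0 <= t0.
Hypothesis t01 : t0 <= t1.
Hypothesis t1T : (t1%:E < T)%E.
Hypothesis Ggam : Gamma gam.
Hypothesis sol : is_solution f g t0 x0 u gam x T.
Hypothesis b_gt0 : 0 < b.
Hypothesis u_ae : {ae mu, forall t, t0 < t <= t1 -> enorm (u t) <= b}.
Hypothesis u_imp : forall t, gam t -> t0 < t <= t1 -> enorm (u t) <= b.

Let v t := V t (x t).
Let N c d := n_imp gam c d.
Let E c d := energy_growth gam c d.
Let level := chi b.
(** Bounds where [v] can land from a left limit at most [chi b]: an impulse yields at most [pi b] if
    the limit is at most [chi |u|] and at most [kap (chi b)] otherwise, and no impulse leaves at
    most [chi b]. The summand [b] makes the excess over [level] strict. *)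
Let reset := pi b + kap (chi b) + chi b + b.

Let enorm_ge0 k (w : 'rV[R]_k) : 0 <= enorm w. Proof. exact: sqrtr_ge0. Qed.

Let level_gt0 : 0 < level.
Proof. by case: Kchi => K _; exact: classK_gt0. Qed.

Let level_lt_reset : level < reset.
Proof.
have [[Kp _] [Kk _]] := (Kpi, Kkap).
have := classK_ge0 Kp (ltW b_gt0); have := classK_ge0 Kk (ltW level_gt0).
by rewrite /reset /level; have := b_gt0; lra.
Qed.

(** The first bound remains useful when the energy growth is positive. The proviso [0 < v d] in the
    second excludes the value 0, where the energy is meaningless; positivity is passed back to [c]
    so that the estimates compose. *)
Definition decrease (c d : R) := v d <= iter (N c d) kap (v c) /\
  (0 < v d -> 0 < v c /\ energy vphi (v d) <= energy vphi (v c) + E c d).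

(* Since [level < reset], right continuity keeps [v <= reset] just after a time
   at which [v <= level]: this is what makes [decrease_or_reset] a local
   property, to which [local_to_global] applies. *)
Definition decrease_or_reset c d := decrease c d \/
  exists r, [/\ c <= r, r <= d, v r <= reset & decrease r d].

Lemma energy_growthD c d e : 0 <= c -> c <= d -> d <= e -> E c e = E c d + E d e.
Proof.
move=> c0 cd de; rewrite /E /energy_growth (n_impD Ggam cd de).
rewrite (itv_integralD p_ge0 p_int c0 cd de) natrD; ring.
Qed.

Lemma n_imp_xx c : N c c = 0%N.
Proof. by apply: n_imp_eq0 => s _ cs sc; move: (lt_le_trans cs sc); rewrite ltxx. Qed.

Lemma decrease_refl c : t0 <= c -> decrease c c.
Proof.
move=> c0; split; first by rewrite n_imp_xx.
move=> vc; split => //.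
by have := energy_growthD (le_trans t0_ge0 c0) (lexx c) (lexx c); lra.
Qed.

Lemma decrease_trans c d e : t0 <= c -> c <= d -> d <= e ->
  decrease c d -> decrease d e -> decrease c e.
Proof.
move=> tc cd de [h1 h2] [h3 h4]; have c0 := le_trans t0_ge0 tc; split.
  apply: le_trans h3 _; rewrite /N (n_impD Ggam cd de) addnC iterD.
  apply: iter_classK_le => //; apply: V_ge0; exact: le_trans cd.
move=> ve; have [vd e1] := h4 ve; have [vc e2] := h2 vd; split => //.
by have := energy_growthD c0 cd de; move: e1 e2; lra.
Qed.

(** Of two resets the later one is kept, since the decrease after it already reaches [e]. *)
Lemma decrease_or_reset_trans c d e : t0 <= c -> c <= d -> d <= e ->
  decrease_or_reset c d -> decrease_or_reset d e -> decrease_or_reset c e.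
Proof.
move=> tc cd de Hcd [Hde|[r [dr re vr Hre]]]; last first.
  by right; exists r; split => //; exact: le_trans dr.
case: Hcd => [Hcd|[r [cr rd vr Hrd]]]; first by left; exact: decrease_trans Hde.
right; exists r; split => //; first exact: le_trans de.
by apply: (@decrease_trans _ d) => //; exact: le_trans cr.
Qed.

Lemma flow_interval_between a s : t0 <= a -> s <= t1 ->
  (forall r, gam r -> a < r -> s <= r) ->
  exists2 tau, tau = 0 \/ gam tau &
    forall t, a <= t -> t < s -> flow_interval gam t0 T tau t.
Proof.
move=> ta st1 noimp.
have [tau [Htau _ taua last]] := Gamma_last Ggam (le_trans t0_ge0 ta).
exists tau => // t at_ ts; split.
- exact: le_trans at_.
- exact: le_trans at_.
- by apply: le_lt_trans t1T; rewrite lee_fin (le_trans (ltW ts)).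
- move=> r gr taur; apply: lt_le_trans ts _; apply: noimp => //.
  by rewrite ltNge; apply/negP => /(last _ gr); rewrite leNgt taur.
Qed.

Lemma solution_abs_continuous a c s : t0 <= a -> a <= c -> c < s -> s <= t1 ->
  (forall r, gam r -> a < r -> s <= r) -> abs_continuous a c x.
Proof.
move=> ta ac cs st1 noimp; have [tau Htau HJ] := flow_interval_between ta st1 noimp.
have [_ _ /(_ _ Htau)[AC _] _] := sol.
apply: AC => // t /=; rewrite in_itv/= => /andP[at_ tc]; apply: HJ => //.
exact: le_lt_trans cs.
Qed.

(** Above [level = chi b] the input bound gives [chi |u| <= v] almost everywhere, which is the
    condition for the flow inequality of [V]. *)
Lemma solution_flow a s w : t0 <= a -> a < s -> s <= t1 ->
  (forall r, gam r -> a < r -> s <= r) ->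
  (forall t, a <= t -> t < s -> level < v t) ->
  v t @[t --> s^'-] --> w -> 0 < w ->
  energy vphi w + itv_integral p a s <= energy vphi (v a).
Proof.
move=> ta as_ st1 noimp vlev vw w0.
have [tau Htau HJ] := flow_interval_between ta st1 noimp.
have [_ _ /(_ _ Htau)[_ aeJ] _] := sol.
apply: (energy_flow LV p_ge0 p_int Pphi (f := f) (u := u)) vw w0 => //.
- exact: le_trans ta.
- by move=> c ac cs; apply: solution_abs_continuous noimp.
- by move=> t at_ ts; apply: lt_trans (vlev t at_ ts).
- have aeI := @filterI _ _ (ae_filter_ringOfSetsType mu) _ _ aeJ u_ae.
  apply: (@filterS _ _ (ae_filter_ringOfSetsType mu) _ _ _ aeI).
  move=> t [H1 H2] /andP[at_ ts]; split; first by apply: H1; apply: HJ => //; exact: ltW.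
  have t0t : t0 < t by exact: le_lt_trans at_.
  apply: flowV; first exact: le_trans (ltW t0t).
  apply: le_trans (ltW (vlev t (ltW at_) ts)).
  case: Kchi => K _; apply: classK_le => //; apply: H2.
  by rewrite t0t (le_trans (ltW ts)).
Qed.

Lemma V_continuous_left s (l : 'rV[R]_n) : 0 < s -> x @ s^'- --> l -> v t @[t --> s^'-] --> V s l.
Proof.
move=> s0 xl; have [r [k [r0 k0 Hr]]] := loc_lipschitz_ball l LV (ltW s0).
apply/cvgrPdist_lt => e e0.
pose e1 := Num.min (Num.min r s) (e / (2 * k)).
have e10 : 0 < e1 by rewrite !lt_min r0 s0/= divr_gt0// mulr_gt0.
have /cvgrPdist_lt/(_ _ e10) := xl.
move=> /nbhs_ballP[d /= d0 Hd].
apply/nbhs_ballP; exists (Num.min d e1) => /=; first by rewrite lt_min d0.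
move=> t; rewrite /ball/= lt_min => /andP[td te] ts.
have xt : `|l - x t| < e1 by exact: Hd.
have [e1r e1s e1k] : [/\ e1 <= r, e1 <= s & k * (2 * e1) <= e].
  split; [by rewrite !ge_min lexx|by rewrite !ge_min lexx orbT|].
  have : e1 <= e / (2 * k) by rewrite ge_min lexx orbT.
  by rewrite ler_pdivlMr ?mulr_gt0//; lra.
apply: le_lt_trans (Hr s l t (x t) _ _ _ _ _ _) _.
- exact: ltW.
- by move: te; rewrite ltr_norml; lra.
- by rewrite subrr normr0.
- by rewrite distrC; exact: lt_le_trans te _.
- by rewrite subrr normr0.
- by rewrite distrC; exact: lt_le_trans xt _.
apply: lt_le_trans e1k; rewrite ltr_pM2l//; lra.
Qed.

(** Away from impulse times the left limit comes from absolute continuity on a closed interval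
    [[a, s]] inside one flow interval; [a] is within [eta / 2] of [s], hence after the last
    impulse. *)
Lemma solution_left_limit s : t0 < s -> s <= t1 ->
  exists l : 'rV[R]_n, [/\ x @ s^'- --> l, gam s -> x s = l + g s l (u s) & ~ gam s -> x s = l].
Proof.
move=> ts st1; have [gs|ngs] := pselect (gam s).
  have [_ _ _ J] := sol; have [|l xl xs] := J s gs ts.
    by apply: le_lt_trans t1T; rewrite lee_fin.
  by exists l.
exists (x s); split => //.
have [eta eta0 iso] := Gamma_isolated s Ggam.
have [tau [Htau tau0 taus last]] := Gamma_last Ggam (le_trans t0_ge0 (ltW ts)).
pose a := Num.max t0 (s - eta / 2).
have ta : t0 <= a by rewrite le_max lexx.
have as_ : a < s by rewrite gt_max ts/=; lra.
have aeta : s - eta / 2 <= a by rewrite le_max lexx orbT.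
have [_ _ /(_ _ Htau)[AC _] _] := sol.
have acx : abs_continuous a s x.
  apply: AC; first exact: ltW.
  move=> t /=; rewrite in_itv/= => /andP[at_ tsle]; split.
  - case: Htau => [->|gtau]; first exact: le_trans (le_trans t0_ge0 ta) at_.
    have : eta <= `|tau - s|.
      by apply: iso => //; apply/eqP => taus'; apply: ngs; rewrite -taus'.
    by rewrite ler0_norm; lra.
  - exact: le_trans at_.
  - by apply: le_lt_trans t1T; rewrite lee_fin (le_trans tsle).
  - move=> r gr taur; apply: le_lt_trans tsle _.
    by rewrite ltNge; apply/negP => /(last _ gr); rewrite leNgt taur.
apply/cvgrPdist_lt => e e0.
have [d d0 Hd] := abs_continuous_unif acx e0.
apply/nbhs_ballP; exists (Num.min d (s - a)) => /=; first by rewrite lt_min d0 subr_gt0.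
move=> t; rewrite /ball/= lt_min => /andP[td ta'] tslt.
apply: Hd => //; first by rewrite (ltW as_) lexx.
by rewrite (ltW tslt) andbT; move: ta'; rewrite gtr0_norm ?subr_gt0//; lra.
Qed.

Lemma solution_right_continuous s e : t0 <= s -> s < t1 -> 0 < e ->
  exists2 eta, 0 < eta & forall d, s <= d -> d < s + eta -> d <= t1 ->
    `|v d - v s| < e.
Proof.
move=> ts st1 e0.
have s0 := le_trans t0_ge0 ts.
have [eta eta0 iso] := Gamma_isolated s Ggam.
have [r [k [r0 k0 Hr]]] := loc_lipschitz_ball (x s) LV s0.
pose c := Num.min t1 (s + eta).
have sc : s < c by rewrite lt_min st1/=; lra.
pose c' := (s + c) / 2.
have sc' : s < c' by rewrite /c'; lra.
have cc' : c' < c by rewrite /c'; lra.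
have noimp r' : gam r' -> s < r' -> c <= r'.
  move=> gr sr; have : eta <= `|r' - s| by apply: iso => //; rewrite gt_eqF.
  rewrite gtr0_norm ?subr_gt0// => H; rewrite ge_min; apply/orP; right; lra.
have ct1 : c <= t1 by rewrite ge_min lexx.
have acx := solution_abs_continuous ts (ltW sc') cc' ct1 noimp.
pose e1 := Num.min r (e / (2 * k)).
have e10 : 0 < e1 by rewrite lt_min r0/= divr_gt0// mulr_gt0.
have [d d0 Hd] := abs_continuous_unif acx e10.
pose eta' := Num.min (c' - s) (Num.min d e1).
exists eta'; first by rewrite /eta' lt_min subr_gt0 sc'/= lt_min d0.
move=> t st; rewrite -ltrBlDl /eta' lt_min => /andP[h1].
rewrite lt_min => /andP[h2 h3] tt1.
have [e1r e1k] : e1 <= r /\ k * (2 * e1) <= e.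
  split; first by rewrite ge_min lexx.
  have : e1 <= e / (2 * k) by rewrite ge_min lexx orbT.
  by rewrite ler_pdivlMr ?mulr_gt0//; lra.
have nts : `|t - s| = t - s by rewrite ger0_norm// subr_ge0.
have xts : `|x t - x s| < e1.
  apply: Hd; rewrite ?nts// ?st ?lexx ?(ltW sc')//=; lra.
apply: le_lt_trans (Hr t (x t) s (x s) _ _ _ _ _ _) _ => //.
- exact: le_trans st.
- by rewrite nts; exact: lt_le_trans e1r.
- by rewrite subrr normr0.
- exact: lt_le_trans e1r.
- by rewrite subrr normr0.
by rewrite nts; apply: lt_le_trans e1k; rewrite ltr_pM2l//; lra.
Qed.

(** If [v s > level], right continuity keeps [v] above [level] for a while, before the next impulse,
    and the flow estimate applies; otherwise the margin [reset - level] absorbs the change of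
    [v]. *)
Lemma right_step s : t0 <= s -> s <= t1 ->
  exists2 eta, 0 < eta & forall d, s <= d -> d < s + eta -> d <= t1 ->
    if level < v s then decrease s d else v d <= reset.
Proof.
move=> ts; rewrite le_eqVlt => /predU1P[->|st1].
  exists 1 => // d td _ dt; have -> : d = t1 by apply/le_anti; rewrite td dt.
  case: ltP => [_|vs]; first exact: decrease_refl.
  by rewrite (le_trans vs)// ltW.
have [vs|vs] := ltP level (v s); last first.
  have e0 : 0 < reset - level by rewrite subr_gt0.
  have [eta eta0 H] := solution_right_continuous ts st1 e0.
  exists eta => // d sd ds dt; have := H d sd ds dt.
  by rewrite ltr_norml; lra.
have e0 : 0 < v s - level by rewrite subr_gt0.
have [eta eta0 H] := solution_right_continuous ts st1 e0.
have [eta' eta'0 iso] := Gamma_isolated s Ggam.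
exists (Num.min eta eta'); first by rewrite lt_min eta0.
move=> d; rewrite le_eqVlt => /predU1P[<- _ _|sd]; first exact: decrease_refl.
rewrite -ltrBlDl lt_min => /andP[h1 h2] dt.
have lev t : s <= t -> t <= d -> level < v t.
  move=> st td; have := H t st _ (le_trans td dt).
  have -> : t < s + eta by lra.
  by move=> /(_ isT); rewrite ltr_norml; lra.
have noimp r : gam r -> s < r -> d < r.
  move=> gr sr; have : eta' <= `|r - s| by apply: iso => //; rewrite gt_eqF.
  by rewrite gtr0_norm ?subr_gt0//; lra.
have N0 : N s d = 0%N.
  by apply: n_imp_eq0 => r gr sr rd; have := noimp r gr sr; rewrite ltNge rd.
have [l [xl _ xd]] := solution_left_limit (le_lt_trans ts sd) dt.
have {}xd : x d = l.
  by apply: xd => gd; have := noimp d gd sd; rewrite ltxx.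
have d0 : 0 < d by exact: le_lt_trans (le_trans t0_ge0 ts) sd.
have vd := V_continuous_left d0 xl; rewrite -xd in vd.
have vd0 : 0 < v d by exact: lt_trans level_gt0 (lev d (ltW sd) (lexx d)).
have vs0 : 0 < v s by exact: lt_trans level_gt0 vs.
have Hflow : energy vphi (v d) + itv_integral p s d <= energy vphi (v s).
  apply: solution_flow => //.
  - by move=> r gr sr; apply/ltW/noimp.
  - by move=> t st td; apply: lev => //; exact: ltW.
have ip := itv_integral_ge0 p_ge0 d (le_trans t0_ge0 ts).
split.
  rewrite N0 /=; apply: (energy_le_inv Pphi) => //; lra.
move=> _; split => //; by rewrite /E /energy_growth -/(N s d) N0 mulr0; move: Hflow; lra.
Qed.

(** The left limit [w] of [v] decides. If [w > level], then [v] exceeds [level] just before [s], and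
    the flow is followed by at most one impulse, costing at most [M] in energy; if [w <= level],
    then [reset] bounds the outcome with or without an impulse. *)
Lemma left_step s : t0 < s -> s <= t1 ->
  exists2 eta, 0 < eta & forall c, t0 <= c -> s - eta < c -> c < s ->
    decrease c s \/ v s <= reset.
Proof.
move=> ts st1.
have [[KK _] [KP _] [KC _]] := And3 Kkap Kpi Kchi.
have [l [xl xg xng]] := solution_left_limit ts st1.
have s0 : 0 < s by exact: le_lt_trans ts.
have vl := V_continuous_left s0 xl.
set w := V s l in vl.
have w_ge0 : 0 <= w by apply: V_ge0; exact: ltW.
have kap0 : 0 <= kap (chi b) by apply: classK_ge0 => //; exact: ltW.
have pi0 : 0 <= pi b by apply: classK_ge0 => //; exact: ltW.
have lev0 := level_gt0.
have us : gam s -> enorm (u s) <= b by move=> gs; apply: u_imp => //; rewrite ts.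
have [wlev|levw] := leP w level.
  exists 1 => // c _ _ _; right.
  have [gs|ngs] := pselect (gam s); last first.
    by rewrite /v xng// (le_trans wlev)// ltW.
  rewrite /v xg//.
  have [wu|uw] := leP w (chi (enorm (u s))).
    apply: le_trans (jump_smallV (ltW s0) wu) _.
    have : pi (enorm (u s)) <= pi b by apply: classK_le => //; exact: us.
    by move: kap0 lev0 b_gt0; rewrite /reset /level; lra.
  (* Here [chi (enorm (u s)) < w <= chi b]: the input at [s] is too small for the bound by [pi], but
     [psi w <= kap (chi b)]. *)
  apply: le_trans (jumpV (ltW s0) (ltW uw)) _.
  have := psi_kap w_ge0.
  have : kap w <= kap (chi b) by apply: classK_le.
  by move: pi0 lev0 b_gt0; rewrite /reset /level -/w; lra.
have e0 : 0 < w - level by rewrite subr_gt0.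
have /cvgrPdist_lt/(_ _ e0) := vl.
move=> /nbhs_ballP[eta /= eta0 Heta].
have [eta' eta'0 iso] := Gamma_isolated s Ggam.
exists (Num.min eta eta'); first by rewrite lt_min eta0.
move=> c tc; rewrite ltrBlDr -ltrBlDl lt_min => /andP[h1 h2] cs; left.
have lev t : c <= t -> t < s -> level < v t.
  move=> ct tlt; have := Heta t; rewrite /ball/= gtr0_norm ?subr_gt0//.
  have -> : s - t < eta by lra.
  by move=> /(_ isT tlt); rewrite ltr_norml; lra.
have noimp r : gam r -> c < r -> s <= r.
  move=> gr cr; rewrite leNgt; apply/negP => rs.
  have : eta' <= `|r - s| by apply: iso => //; rewrite lt_eqF.
  by rewrite ltr0_norm ?subr_lt0//; lra.
have w0 : 0 < w by exact: lt_trans levw.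
have Hflow : energy vphi w + itv_integral p c s <= energy vphi (v c).
  exact: solution_flow.
have vc0 : 0 < v c by exact: lt_trans (lev c (lexx c) cs).
have ip := itv_integral_ge0 p_ge0 s (le_trans t0_ge0 tc).
have wvc : w <= v c by apply: (energy_le_inv Pphi) => //; lra.
have [gs|ngs] := pselect (gam s); last first.
  have N0 : N c s = 0%N.
    apply: n_imp_eq0 => r gr cr rs; apply: ngs.
    by have <- : r = s by apply/le_anti; rewrite rs noimp.
  have vs : v s = w by rewrite /v xng.
  split; first by rewrite N0 vs.
  move=> _; split => //; by rewrite vs /E /energy_growth -/(N c s) N0 mulr0; move: Hflow; lra.
have N1 : N c s = 1%N.
  apply: (n_imp_eq1 gs); first by rewrite cs lexx.
  by move=> r gr cr rs; apply/le_anti; rewrite rs noimp.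
have uw : chi (enorm (u s)) <= w.
  by apply/ltW; apply: le_lt_trans levw; apply: classK_le => //; exact: us.
have vs : v s <= psi w by rewrite /v xg//; apply: jumpV => //; exact: ltW.
split.
  rewrite N1/=; apply: le_trans vs _; apply: le_trans (psi_kap w_ge0) _.
  exact: classK_le.
move=> vs0; split => //.
have psiw : 0 < psi w by exact: lt_le_trans vs.
have := energy_le Pphi vs0 vs.
have := jumpM w0; rewrite -(energyB Pphi w0 psiw).
by rewrite /E /energy_growth -/(N c s) N1 mulr1; move: Hflow; lra.
Qed.

Lemma solution_decrease_or_reset : decrease_or_reset t0 t1.
Proof.
apply: (@local_to_global R decrease_or_reset t0 t1) => //.
  by move=> c d e tc cd de _; exact: decrease_or_reset_trans.
move=> s ts st1; have [eta eta0 Hr] := right_step ts st1.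
have right_ok d : s <= d -> d < s + eta -> d <= t1 -> decrease_or_reset s d.
  move=> sd ds dt; have := Hr d sd ds dt; case: ltP => _ H; first by left.
  by right; exists d; split => //; apply: decrease_refl; exact: le_trans sd.
move: ts; rewrite le_eqVlt => /predU1P[ts|ts].
  exists eta => // c d tc cs sd dt _ ds.
  have -> : c = s by apply/le_anti; rewrite cs -ts tc.
  exact: right_ok.
have [eta' eta'0 Hl] := left_step ts st1.
exists (Num.min eta eta'); first by rewrite lt_min eta0.
move=> c d tc + sd dt sc; rewrite -ltrBlDl lt_min => + /andP[ds _].
have sd' := right_ok d sd _ dt.
have dse : d < s + eta by lra.
rewrite le_eqVlt => /predU1P[->|cs]; first exact: sd'.
apply: (decrease_or_reset_trans tc (ltW cs) sd); last exact: sd'.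
have [|//|vs] := Hl c tc _ cs.
- have : Num.min eta eta' <= eta' by rewrite ge_min lexx orbT.
  lra.
- by left.
- right; exists s; split => //; first exact: ltW.
  by apply: decrease_refl; exact: ltW.
Qed.

End trajectory.

(** * Input-to-state stability *)

Section input_norm.
Variables (R : realType) (m : nat).
Notation mu := (@lebesgue_measure R).

Lemma finite_ubound (A : set R) (F : R -> R) : finite_set A ->
  exists C, forall r, A r -> F r <= C.
Proof.
move=> /finite_seqP[l ->]; elim: l => [|a l [C HC]]; first by exists 0.
exists (Num.max (F a) C) => r /=; rewrite in_cons le_max => /predU1P[->|/HC ->].
  by rewrite lexx.
by rewrite orbT.
Qed.

(** Local essential boundedness of the input and finiteness of the impulses in []t0, t]] make the
    extended norm finite, so [fine] loses nothing. *)
Lemma input_norm_bound (u : R -> 'rV[R]_m) gam (t0 t : R) :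
  0 <= t0 -> t0 <= t -> is_input u -> Gamma gam ->
  [/\ 0 <= input_norm u gam `]t0, t],
      {ae mu, forall s, t0 < s <= t -> enorm (u s) <= input_norm u gam `]t0, t]}
    & forall s, gam s -> t0 < s <= t -> enorm (u s) <= input_norm u gam `]t0, t]].
Proof.
move=> t00 t0t [_ bnd] G; have [C HC] := bnd t (le_trans t00 t0t).
have [C2 HC2] := finite_ubound (fun s => enorm (u s)) (Gamma_itv_finite t0 t G).
set I : set R := `]t0, t]%classic.
pose w := ((fun s => (enorm (u s))%:E) \_ I)%E.
have enorm_ge0 s : 0 <= enorm (u s) by exact: sqrtr_ge0.
have w0 : {ae mu, forall s, (0 <= w s)%E}.
  by apply: aeW => s; rewrite /w patchE; case: ifP => // _; rewrite lee_fin.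
have ess0 : (0 <= ess_sup mu w)%E.
  apply: ess_sup_gee => //=; rewrite -set_itvNyy lebesgue_measure_itv/=.
  by rewrite addye// ltry.
have essC : (ess_sup mu w <= (Num.max 0 C)%:E)%E.
  apply/ess_supP; apply: (@filterS _ _ (ae_filter_ringOfSetsType mu) _ _ _ HC) => s Hs.
  rewrite /w patchE; case: ifPn => [|_]; last by rewrite lee_fin le_max lexx.
  rewrite inE /I/= in_itv/= => /andP[ts st].
  by rewrite lee_fin le_max Hs ?orbT// st (le_trans t00 (ltW ts)).
pose s2 := ereal_sup [set (enorm (u t))%:E | t in gam `&` I].
have s2C : (s2 <= C2%:E)%E.
  by apply: ge_ereal_sup => _ [s gs <-]; rewrite lee_fin; exact: HC2.
have e0 : (0 <= input_enorm u gam I)%E.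
  by rewrite /input_enorm le_max ess0.
have fin : input_enorm u gam I \is a fin_num.
  rewrite ge0_fin_numE// /input_enorm gt_max.
  by rewrite (le_lt_trans essC) ?ltry//= (le_lt_trans s2C) ?ltry.
have nE : ((input_norm u gam I)%:E = input_enorm u gam I)%E by rewrite fineK.
split.
- by rewrite fine_ge0.
- apply: (@filterS _ _ (ae_filter_ringOfSetsType mu) _ _ _ (ess_sup_ge mu w)) => s.
  rewrite {1}/w patchE => + tst; rewrite mem_set ?/I/= ?in_itv// => H.
  rewrite -lee_fin nE; apply: le_trans H _.
  by rewrite /input_enorm le_max lexx.
- move=> s gs tst; rewrite -lee_fin nE /input_enorm le_max; apply/orP; right.
  by apply: ereal_sup_ubound; exists s => //; split => //; rewrite /I/= in_itv.
Qed.

End input_norm.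

Section ISS.
Variables (R : realType) (n m : nat).
Variables (f g : R -> 'rV[R]_n -> 'rV[R]_m -> 'rV[R]_n).
Variables (ho h V : R -> 'rV[R]_n -> R).
Variables (chi pi p vphi psi : R -> R) (M : R).
Variables (S : set (set R)) (clock : set R -> R -> R -> R).

(** The common core of all cases. Bounded overshoot asks that at most [K] impulses occur wherever
    the growth may be positive; uniform attraction asks that a large clock force an arbitrarily
    negative growth. *)
Lemma clock_ISS :
  (forall (t : R) xi, 0 <= t -> 0 <= ho t xi) ->
  (forall (t : R) xi, 0 <= t -> 0 <= h t xi) ->
  ISS_Lyapunov_candidate f g ho h V chi pi p vphi psi ->
  classP vphi ->
  (forall a, 0 < a -> oriented_int (fun s => (vphi s)^-1) a (psi a) <= M) ->
  S `<=` @Gamma R ->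
  (forall gam r t, S gam -> 0 <= r -> r <= t -> 0 <= clock gam r t) ->
  (exists K : nat, forall gam r t, S gam -> 0 <= r -> r <= t ->
     energy_growth p M gam r t <= 0 \/ (n_imp gam r t <= K)%N) ->
  (forall L, exists C, forall gam r t, S gam -> 0 <= r -> r <= t ->
     C <= clock gam r t -> energy_growth p M gam r t <= - L) ->
  exists (beta : R -> R -> R) (rho : R -> R), [/\ classKL beta, classKoo rho &
    forall (t0 : R) (x0 : 'rV[R]_n) u gam x T, 0 <= t0 -> is_input u -> S gam ->
      is_maximal_solution f g t0 x0 u gam x T ->
      forall t : R, t0 <= t -> (t%:E < T)%E ->
        h t (x t) <= beta (ho t0 x0) (clock gam t0 t)
                     + rho (input_norm u gam `]t0, t])].
Proof.
move=> ho0 h0 [LV [phi1 [phi2 [K1 K2 sandwich]]] [Kchi Kpi Ppsi] [p0 pint _] cand].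
move=> Pphi jumpM SG clock0 [K HK] HB.
have V0 t xi : 0 <= t -> 0 <= V t xi.
  move=> t0; have [+ _] := sandwich t xi t0; apply: le_trans.
  by case: K1 => K1 _; apply: classK_ge0 => //; exact: h0.
have [kap [Kkap psikap kapge]] := classP_majorant Ppsi.
have [inv Kinv Hinv] := classKoo_inv K1.
have Kit := classKoo_iter K Kkap.
pose reset b := pi b + kap (chi b) + chi b + b.
have Kreset : classKoo reset.
  apply: (classKoo_add _ (@classKoo_id R)); apply: (classKoo_add _ Kchi).
  exact: (classKoo_add Kpi (classKoo_comp Kkap Kchi)).
(* [reset b] bounds [v] at a reset, [K] iterates of [kap] bound any later overshoot, and [inv]
   returns from [V] to [h]. *)
pose rho := inv \o (iter K kap \o reset).
have Krho : classKoo rho by do 2 apply: classKoo_comp => //.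
pose alpha := inv \o (iter K kap \o phi2).
have Kalpha : classKoo alpha by do 2 apply: classKoo_comp => //.
(* Abstract data of a decrease from [v0 <= phi2 a] to [v1 >= phi1 w] at clock value [s]. Quantifying
   over all sequences and times at once makes the resulting bounds uniform. *)
pose O a s w := exists gam r t v0 v1, [/\ S gam, 0 <= r, r <= t, s = clock gam r t &
  [/\ (0 <= a) && (0 <= w), phi1 w <= v1, 0 <= v0 <= phi2 a,
     v1 <= iter (n_imp gam r t) kap v0 &
     0 < v1 -> 0 < v0 /\ energy vphi v1 <= energy vphi v0 + energy_growth p M gam r t]].
have bounded gam r t v0 v1 : S gam -> 0 <= r -> r <= t -> 0 <= v0 ->
    v1 <= iter (n_imp gam r t) kap v0 ->
    (0 < v1 -> 0 < v0 /\ energy vphi v1 <= energy vphi v0 + energy_growth p M gam r t) ->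
    v1 <= iter K kap v0.
  move=> Sgam r0 rt v00 H1 H2; have [E0|nK] := HK gam r t Sgam r0 rt; last first.
    by apply: le_trans H1 _; apply: iter_ge_le.
  apply: (@le_trans _ _ v0); last exact: (@iter_ge_le _ kap 0 K).
  have [v1_le|v1_gt] := leP v1 0; first exact: le_trans v00.
  by have [v0_gt e1] := H2 v1_gt; apply: (energy_le_inv Pphi) => //; lra.
have [||beta Kbeta Hbeta] := @classKL_majorant R O alpha Kalpha.
- move=> a s w [gam [r [t [v0 [v1 [Sgam r0 rt -> [/andP[a0 w0] pw /andP[v00 v0a] H1 H2]]]]]]].
  split => //; first exact: clock0.
  apply: Hinv => //=; first by case: (classKoo_comp Kit K2) => KK _; exact: (classK_ge0 KK a0).
  apply: le_trans pw _; apply: le_trans (bounded _ _ _ _ _ Sgam r0 rt v00 H1 H2) _.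
  exact: iter_classK_le.
- move=> r1 e e0.
  have [K1' _] := K1; have [K2' _] := K2.
  have e1 : 0 < phi1 e by exact: classK_gt0.
  (* With this [L], the energy of [v1] would be at most that of [phi1 e] minus 1, contradicting
     [phi1 e < v1]. *)
  have [C HC] := HB (energy vphi (phi2 r1) - energy vphi (phi1 e) + 1).
  exists C => a s w.
  move=> [gam [r [t [v0 [v1 [Sgam r0 rt -> [/andP[a0 w0] pw /andP[v00 v0a] H1 H2]]]]]]] ar Cs.
  have E1 := HC gam r t Sgam r0 rt Cs.
  apply: (classK_le_inv K1'); first exact: ltW.
  apply: le_trans pw _; rewrite leNgt; apply/negP => ev.
  have v1_gt : 0 < v1 by exact: lt_trans ev.
  have [v0_gt e2] := H2 v1_gt.
  have v0r : v0 <= phi2 r1 by apply: le_trans v0a _; exact: classK_le.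
  have := energy_le Pphi v0_gt v0r; have := energy_lt Pphi e1 ev.
  by move: e2 E1; lra.
exists beta, rho; split => // t0 x0 u gam x T t00 inu Sgam [sol _] t t0t tT.
have Ggam := SG _ Sgam.
have t_ge0 := le_trans t00 t0t.
have [nu0 nu_ae nu_imp] := input_norm_bound t00 t0t inu Ggam.
set nu := input_norm u gam _ in nu0 nu_ae nu_imp *.
(* A bound [b] strictly above the norm is positive even for zero input, so the level [chi b] is
   positive; continuity of [rho] then lets [b] tend to the norm. *)
suff main b : nu < b -> h t (x t) <= beta (ho t0 x0) (clock gam t0 t) + rho b.
  apply/ler_addgt0Pr => e e0.
  have [[[/continuous_classC0P crho _ _] _] _] := Krho.
  have [d d0 Hd] := crho nu nu0 e e0.
  have nud : nu < nu + d / 2 by lra.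
  have nud0 : 0 <= nu + d / 2 by lra.
  have dist : `|nu + d / 2 - nu| < d.
    by rewrite addrAC subrr add0r gtr0_norm; lra.
  by have := main _ nud; have := Hd _ nud0 dist; rewrite ltr_norml; lra.
move=> nub; have b0 : 0 < b by exact: le_lt_trans nub.
have beta0 : 0 <= beta (ho t0 x0) (clock gam t0 t).
  case: Kbeta => _ /(_ (clock gam t0 t)) H _ _.
  by have := classK_ge0 (H (clock0 _ _ _ Sgam t00 t0t)) (ho0 t0 x0 t00).
have rho0 : 0 <= rho b by case: Krho => Kr _; apply: classK_ge0 => //; exact: ltW.
have flowV s xi w : 0 <= s -> chi (enorm w) <= V s xi ->
    (upper_dini f V s xi w <= (- (p s * vphi (V s xi)))%:E)%E.
  by move=> s0; have [] := cand s xi w s0.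
have jumpV s xi w : 0 <= s -> chi (enorm w) <= V s xi ->
    V s (xi + g s xi w) <= psi (V s xi).
  by move=> s0; have [] := cand s xi w s0.
have jump_smallV s xi w : 0 <= s -> V s xi <= chi (enorm w) ->
    V s (xi + g s xi w) <= pi (enorm w).
  by move=> s0; have [] := cand s xi w s0.
have x0E : x t0 = x0 by case: sol.
have u_ae : {ae @lebesgue_measure R, forall s, t0 < s <= t -> enorm (u s) <= b}.
  apply: (@filterS _ _ (ae_filter_ringOfSetsType _) _ _ _ nu_ae) => s Hs ts.
  exact: le_trans (Hs ts) (ltW nub).
have u_imp s : gam s -> t0 < s <= t -> enorm (u s) <= b.
  by move=> gs ts; exact: le_trans (nu_imp s gs ts) (ltW nub).
have [phiV Vphi] := sandwich t (x t) t_ge0.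
have := solution_decrease_or_reset LV V0 p0 pint Pphi Kchi Kpi Kkap psikap
  flowV jumpV jump_smallV jumpM t00 t0t tT Ggam sol b0 u_ae u_imp.
case=> [[H1 H2]|[r [tr rt vr [H1 H2]]]].
  have : O (ho t0 x0) (clock gam t0 t) (h t (x t)).
    exists gam, t0, t, (V t0 (x t0)), (V t (x t)); split => //; split => //.
    - by rewrite ho0// h0.
    - by rewrite V0//= x0E; have [] := sandwich t0 x0 t00.
  by move=> /Hbeta; lra.
have r0 := le_trans t00 tr.
have := bounded gam r t _ _ Sgam r0 rt (V0 r (x r) r0) H1 H2 => vt.
have reset0 : 0 <= reset b by apply: le_trans vr; exact: V0.
have : h t (x t) <= rho b.
  apply: Hinv => //=; last 2 first.
  - exact: h0.
  - apply: le_trans phiV _; apply: le_trans vt _.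
    by apply: iter_classK_le => //; exact: V0.
  by case: Kit => KK _; exact: classK_ge0.
by lra.
Qed.

End ISS.

(** * Energy growth under dwell-time conditions *)

Section rates.
Variables (R : realType) (p : R -> R) (theta N : R).
Hypothesis p_ge0 : forall t, 0 <= t -> 0 <= p t.
Hypothesis p_int : loc_integrable p.
Hypothesis theta_gt0 : 0 < theta.
Hypothesis N_ge0 : 0 <= N.
Hypothesis flowN : forall t, 0 <= t -> N <= itv_integral p t (t + theta).
Implicit Types gam : set R.

(** The integer part of [(t - r) / theta] counts the full windows in []r, t]], each contributing at
    least [N]; the [- 1] pays for the incomplete one. *)
Lemma itv_integral_lower r t : 0 <= r -> r <= t ->
  N * ((t - r) / theta - 1) <= itv_integral p r t.
Proof.
move=> r0 rt.
have ind k : N * k%:R <= itv_integral p r (r + k%:R * theta).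
  elim: k => [|k IH]; first by rewrite mulr0; exact: itv_integral_ge0.
  have k0 : 0 <= k%:R * theta by rewrite mulr_ge0// ltW.
  have rk0 : 0 <= r + k%:R * theta by lra.
  have := flowN rk0.
  rewrite (@itv_integralD _ _ p_ge0 p_int r (r + k%:R * theta)) -?natr1 ?mulrDl ?mul1r//.
  - by rewrite mulrDr mulr1 addrA; lra.
  - by rewrite lerDl.
  - by rewrite addrA lerDl ltW.
have q0 : 0 <= (t - r) / theta by rewrite divr_ge0 ?subr_ge0// ltW.
have /andP[h1 h2] := truncn_itv q0.
set k := Num.truncn _ in h1 h2.
have k0 : 0 <= k%:R * theta by rewrite mulr_ge0// ltW.
have kt : r + k%:R * theta <= t by move: h1; rewrite ler_pdivlMr//; lra.
rewrite (@itv_integralD _ _ p_ge0 p_int r (r + k%:R * theta))//; last by rewrite lerDl.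
have := itv_integral_ge0 p_ge0 t (addr_ge0 r0 k0).
have := ind k.
have : N * ((t - r) / theta - 1) <= N * k%:R.
  by apply: ler_wpM2l => //; move: h2; rewrite -natr1; lra.
lra.
Qed.

Lemma energy_growth_le M gam r t : 0 <= r -> r <= t ->
  energy_growth p M gam r t <= M * (n_imp gam r t)%:R + N - N / theta * (t - r).
Proof.
move=> r0 rt; have := itv_integral_lower r0 rt.
have -> : N * ((t - r) / theta - 1) = N / theta * (t - r) - N by ring.
by rewrite /energy_growth; lra.
Qed.

(** On long intervals the linear decay makes the growth negative, and on short ones the number of
    impulses is bounded. The latter also shows that a large value of [t - r + n], with [n] impulses,
    forces a large [t - r]. *)
Lemma growth_from_density (S : set (set R)) (M a delta T1 : R) : 0 < delta ->
  (forall gam r t, S gam -> 0 <= r -> r <= t -> T1 <= t - r ->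
     energy_growth p M gam r t <= a - delta * (t - r)) ->
  (forall X : R, exists B : R, forall gam r t, S gam -> 0 <= r -> r <= t ->
     t - r <= X -> (n_imp gam r t)%:R <= B) ->
  (exists K : nat, forall gam r t, S gam -> 0 <= r -> r <= t ->
     energy_growth p M gam r t <= 0 \/ (n_imp gam r t <= K)%N) /\
  (forall L : R, exists C : R, forall gam r t, S gam -> 0 <= r -> r <= t ->
     C <= t - r + (n_imp gam r t)%:R -> energy_growth p M gam r t <= - L).
Proof.
move=> d0 H1 H2.
have long (L : R) : exists X : R, forall gam r t, S gam -> 0 <= r -> r <= t -> X <= t - r ->
    energy_growth p M gam r t <= - L.
  exists (Num.max T1 ((a + L) / delta)) => gam r t Sg r0 rt.
  rewrite ge_max => /andP[h1]; rewrite ler_pdivrMr// => h2.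
  by have := H1 gam r t Sg r0 rt h1; lra.
split.
  have [X HX] := long 0; have [B HB] := H2 X.
  exists (Num.truncn `|B|).+1 => gam r t Sg r0 rt.
  have [Xt|tX] := leP X (t - r).
    by left; have := HX gam r t Sg r0 rt Xt; rewrite oppr0.
  right; rewrite -(@ler_nat R); apply: le_trans (HB gam r t Sg r0 rt (ltW tX)) _.
  have /andP[_ h] := truncn_itv (normr_ge0 B).
  by apply: le_trans (ler_norm B) (ltW h).
move=> L; have [X HX] := long L; have [B HB] := H2 X.
exists (X + B) => gam r t Sg r0 rt XB.
apply: HX => //; rewrite leNgt; apply/negP => tX.
have := HB gam r t Sg r0 rt (ltW tX); lra.
Qed.

End rates.

Theorem theorem4p1 (R : realType) (n m : nat)
    (f g : R -> 'rV[R]_n -> 'rV[R]_m -> 'rV[R]_n)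
    (ho h V : R -> 'rV[R]_n -> R)
    (chi pi p vphi psi : R -> R) (theta : R) :
  (forall u : R -> 'rV[R]_m, is_input u ->
     caratheodory (fun t xi => f t xi (u t))) ->
  (forall (t : R) xi, 0 <= t -> 0 <= ho t xi) ->
  (forall (t : R) xi, 0 <= t -> 0 <= h t xi) ->
  ISS_Lyapunov_candidate f g ho h V chi pi p vphi psi ->
  classP psi -> classP vphi ->
  0 < theta ->
  let M := jump_sup vphi psi in
  let N := flow_inf p theta in
  (M < N)%E ->
  [/\ (0 < M)%E -> forall S : set (set R), S `<=` @Gamma R ->
        uniform_subset_Sbar S (1 / theta) -> strongly_ISS f g ho h S,
      M = 0%E ->
        weakly_ISS f g ho h (@Gamma R) /\
        (forall S : set (set R), S `<=` @Gamma R -> UIB S ->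
           strongly_ISS f g ho h S)
    & (M < 0)%E -> (0 < N)%E -> strongly_ISS f g ho h (@Gamma R)].
Proof.
move=> _ ho0 h0 cand Ppsi Pphi th0 M N MN.
have [_ _ _ [p0 pint _] _] := cand.
have flowN_le t : 0 <= t -> (N <= (itv_integral p t (t + theta))%:E)%E.
  exact: (flow_inf_le p0 pint (ltW th0)).
have N0 : (0 <= N)%E.
  apply: le_ereal_inf_tmp => _ [t t0 <-]; apply: integral_ge0 => s /=.
  move: t0; rewrite /= !in_itv/= andbT => t0 /andP[ts _].
  by rewrite lee_fin; apply: p0; exact: le_trans ts.
have Nfin : N \is a fin_num.
  by rewrite ge0_fin_numE//; apply: le_lt_trans (flowN_le 0 (lexx _)) (ltry _).
have jumpM_le a : 0 < a ->
    ((oriented_int (fun s => (vphi s)^-1) a (psi a))%:E <= M)%E.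
  by move=> a0; apply: ereal_sup_ubound; exists a => //=; rewrite in_itv/= a0.
(* Above, [M < N] with [N] finite; below, the integral for [a = 1] is a real lower bound. *)
have Mfin : M \is a fin_num.
  rewrite fin_numElt (lt_trans MN) ?ltey_eq ?Nfin// andbT.
  exact: lt_le_trans (ltNyr _) (jumpM_le 1 ltr01).
pose Mr := fine M; pose Nr := fine N.
have ME : M = Mr%:E by rewrite fineK.
have NE : N = Nr%:E by rewrite fineK.
have flowN t : 0 <= t -> Nr <= itv_integral p t (t + theta).
  by move=> t0; rewrite -lee_fin -NE; exact: flowN_le.
have jumpM a : 0 < a -> oriented_int (fun s => (vphi s)^-1) a (psi a) <= Mr.
  by move=> a0; rewrite -lee_fin -ME; exact: jumpM_le.
rewrite ME NE lte_fin in MN N0 *; rewrite lee_fin in N0; rewrite !lte_fin.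
have growth gam r t := @energy_growth_le R p theta Nr p0 pint th0 N0 flowN Mr gam r t.
have clock0 gam (r t : R) : r <= t -> 0 <= t - r + (n_imp gam r t)%:R.
  by move=> rt; rewrite addr_ge0// subr_ge0.
have ISS_of_clock := clock_ISS ho0 h0 cand Pphi jumpM.
split.
- move=> M0 S SG [_ unif].
  have NM0 : 0 < Nr - Mr by rewrite subr_gt0.
  (* Makes [Mr * (1 / theta + eps)] the midpoint of [Mr / theta] and [Nr / theta], which leaves the
     decay rate [(Nr - Mr) / (2 * theta)]. *)
  pose eps := (Nr - Mr) / (2 * theta * Mr).
  have eps0 : 0 < eps by rewrite divr_gt0// !mulr_gt0.
  have [T1 T10 HT] := unif eps eps0.
  pose rate := 1 / theta + eps.
  have rate0 : 0 <= rate.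
    by apply: addr_ge0; [exact: divr_ge0 (ltW th0)|exact: ltW].
  have count gam r t : S gam -> 0 <= r -> T1 <= t - r ->
      (n_imp gam r t)%:R <= rate * (t - r).
    move=> Sg r0 T1t; have := HT gam Sg r (t - r) r0 T1t.
    by rewrite addrC subrK ler_pdivrMr//; exact: lt_le_trans T1t.
  have [|||HA HB] := @growth_from_density R p S Mr Nr ((Nr - Mr) / (2 * theta)) T1.
  + by rewrite divr_gt0// mulr_gt0.
  + move=> gam r t Sg r0 rt T1t; apply: le_trans (growth gam r t r0 rt) _.
    have := ler_wpM2l (ltW M0) (count gam r t Sg r0 T1t).
    have -> : Mr * (rate * (t - r)) =
        Nr / theta * (t - r) - (Nr - Mr) / (2 * theta) * (t - r).
      by rewrite /rate /eps; field; rewrite !gt_eqF.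
    lra.
  (* The rate bound starts at length [T1]; shorter intervals are enlarged to length
     [Num.max T1 X]. *)
  + move=> X; exists (rate * Num.max T1 X) => gam r t Sg r0 rt tX.
    have tX' : t <= r + Num.max T1 X.
      by rewrite -lerBlDl le_max tX orbT.
    apply: (@le_trans _ _ (n_imp gam r (r + Num.max T1 X))%:R).
      by rewrite ler_nat; apply: n_imp_le => //; exact: SG.
    have := count gam r (r + Num.max T1 X) Sg r0.
    by rewrite addrC addKr le_max lexx => /(_ isT).
  apply: (ISS_of_clock S (fun gam r t => t - r + (n_imp gam r t)%:R)) => //.
  by move=> gam r t _ _; exact: clock0.
- move=> /eqP; rewrite eqe => /eqP M0.
  have Npos : 0 < Nr by rewrite -M0.
  have d0 : 0 < Nr / theta by exact: divr_gt0.
  split.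
    apply: (ISS_of_clock _ (fun gam r t => t - r)) => //.
    + by move=> gam r t _ _ rt; rewrite subr_ge0.
    (* With [M = 0] impulses do not raise the energy bound, so the growth is nonpositive for any
       number of them. *)
    + exists 0%N => gam r t _ r0 rt; left.
      by rewrite /energy_growth M0 mul0r sub0r oppr_le0 itv_integral_ge0.
    + move=> L; exists ((Nr + L) / (Nr / theta)) => gam r t _ r0 rt.
      rewrite ler_pdivrMr// => Ct; apply: le_trans (growth gam r t r0 rt) _.
      by rewrite M0 mul0r; lra.
  move=> S SG [phi [_ _ phi_mono Hphi]].
  have [||HA HB] := @growth_from_density R p S Mr Nr (Nr / theta) 0 d0.
  + move=> gam r t Sg r0 rt _; apply: le_trans (growth gam r t r0 rt) _.
    by rewrite M0 mul0r; lra.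
  (* [phi] is controlled at positive arguments only, hence the maximum with 1. *)
  + move=> X; exists (phi (Num.max 1 X)) => gam r t Sg r0 rt tX.
    have X0 : 0 < Num.max 1 X by rewrite lt_max ltr01.
    have tX' : t <= r + Num.max 1 X by rewrite -lerBlDl le_max tX orbT.
    apply: (@le_trans _ _ (n_imp gam r (r + Num.max 1 X))%:R).
      by rewrite ler_nat; apply: n_imp_le => //; exact: SG.
    have := Hphi gam r (r + Num.max 1 X) Sg r0.
    have -> : r + Num.max 1 X - r = Num.max 1 X by rewrite addrC addKr.
    by apply; rewrite ltrDl.
  apply: (ISS_of_clock S (fun gam r t => t - r + (n_imp gam r t)%:R)) => //.
  by move=> gam r t _ _; exact: clock0.
- move=> M0 Npos.
  have d0 : 0 < Nr / theta by exact: divr_gt0.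
  (* For [M < 0] time and impulses both lower the energy; [k] is the slower of the two rates, so
     with [n] impulses the growth is at most [Nr - k * (t - r + n)]. *)
  pose k := Num.min (Nr / theta) (- Mr).
  have k0 : 0 < k by rewrite lt_min d0 oppr_gt0.
  apply: (ISS_of_clock _ (fun gam r t => t - r + (n_imp gam r t)%:R)) => //.
  + by move=> gam r t _ _; exact: clock0.
  + exists 0%N => gam r t _ r0 rt; left.
    have := itv_integral_ge0 p0 t r0.
    have : Mr * (n_imp gam r t)%:R <= 0 by rewrite mulr_le0_ge0// ltW.
    by rewrite /energy_growth; lra.
  + move=> L; exists ((Nr + L) / k) => gam r t _ r0 rt.
    rewrite ler_pdivrMr// => Ct; apply: le_trans (growth gam r t r0 rt) _.
    have tr0 : 0 <= t - r by rewrite subr_ge0.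
    have k1 : k * (t - r) <= Nr / theta * (t - r).
      by apply: ler_wpM2r => //; rewrite ge_min lexx.
    have k2 : k * (n_imp gam r t)%:R <= - Mr * (n_imp gam r t)%:R.
      by apply: ler_wpM2r => //; rewrite ge_min lexx orbT.
    lra.
Qed.
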